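(* Let $D$ be a UDAF digraph with $D=D^\circ$. The UDAF dimension monoid of $D$ is presented as a commutative monoid by $$\Big\langle V_{D^\circ}\ \Big|\ v=\sum_{w\in V_{D^\circ}}\big((v,w)\operatorname{Adj}_{D^\circ}\big)\cdot w\ \text{ for all } v\in V_{D^\circ}\Big\rangle .$$ Moreover, the refining monoid $\operatorname{Refine}(D)$ is generated by the rows of $\operatorname{Rel}_{D^\circ}$ (regarded as elements of $\mathbb Z^{V_{D^\circ}}$).
   Context: $\mathbb N$ includes $0$; maps are written on the right of their arguments, and $p\circ q$ means first $p$, then $q$. A digraph $D=(V_D,E_D,s_D,t_D)$ consists of a vertex set, an edge set and functions $s_D,t_D:E_D\to V_D$ ($e$ is an edge from $(e)s_D$ to $(e)t_D$). A homomorphism $\phi:D_1\to D_2$ is a pair of maps $\phi_V$ on vertices, $\phi_E$ on edges compatible with $s$ and $t$; $\operatorname{Hom}(D_1,D_2)$ is the set of these. For $n\le m$ in $\mathbb Z\cup\{\pm\infty\}$, $\mathbb Z_{[n,m]}$ is the digraph with vertices the integers $i$ with $n\le i\le m$ and an edge $(i,i+1)$ from $i$ to $i+1$ whenever both are vertices. A finite walk in $D$ of length $n\ge 0$ is an element of $\operatorname{Hom}(\mathbb Z_{[0,n]},D)$; a bi-infinite walk is an element of $\operatorname{Hom}(\mathbb Z_{[-\infty,\infty]},D)$. A UDAF digraph is a finite digraph $D$ such that for every $v\in V_D$ the number of $h\in\operatorname{Hom}(\mathbb Z_{[0,\infty]},D)$ with $(0)h_V=v$ is not $1$ and the number of $h\in\operatorname{Hom}(\mathbb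 Z_{[-\infty,0]},D)$ with $(0)h_V=v$ is not $1$. The core $D^\circ$ is the subdigraph of all edges and vertices occurring in bi-infinite walks in $D$. $(v,w)\operatorname{Adj}_D$ is the number of edges from $v$ to $w$; $\operatorname{Rel}_D=\operatorname{Adj}_D-I_D$ where $I_D$ is the identity matrix indexed by $V_D$. A walk $w\in\operatorname{Hom}(\mathbb Z_{[-\infty,0]},D)$ is rational if there are integers $n\le0$, $m\le-1$ with $(i)w_V=(i+m)w_V$ and $(i,i+1)w_E=(i+m,i+1+m)w_E$ for all $i<n$; otherwise irrational. Let $\sigma$ be the automorphism $i\mapsto i+1$ of $\mathbb Z_{[-\infty,\infty]}$. If $w$ is a bi-infinite walk in $D$ with $w\restriction_{\mathbb Z_{[-\infty,0]}}$ irrational and $n\in\mathbb Z$, let $R(w,n)=\{h\in\operatorname{Hom}(\mathbb Z_{[-\infty,\infty]},D): h\restriction_{\mathbb Z_{[-\infty,n]}}=w\restriction_{\mathbb Z_{[-\infty,n]}}\}$ and $R^u(w,n)=\{\langle\sigma\rangle\circ h:h\in R(w,n)\}$, where $\langle\sigma\rangle\circ h=\{\sigma^k\circ h:k\in\mathbb Z\}$. The sets $R^u(w,n)$ are the unindexed rays, and $(n)w_V$ is a central vertex of $R^u(w,n)$ (a ray may have several central vertices, coming from different representations). An unindexed beam is a finite union of unindexed rays. A multiset $M\in\mathbb N^{V_{D^\circ}}$ is a vertex count (vertex counter) for an unindexed beam $B$ if $B$ is a disjoint union of unindexed rays $R_0,\dots,R_{k-1}$ having central vertices $v_0,\dots,v_{k-1}$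 respectively with $(v)M=|\{i<k:v_i=v\}|$ for all $v\in V_{D^\circ}$. The relation $\sim_D$ is the equivalence relation on $\mathbb N^{V_{D^\circ}}$ generated by pairs $(M_1,M_2)$ which are both vertex counts of a common unindexed beam; it is a congruence on the additive monoid $\mathbb N^{V_{D^\circ}}$. The UDAF dimension monoid of $D$ is $\mathbb N^{V_{D^\circ}}/\sim_D$. An elementary refiner is a map $R:V_{D^\circ}\to\mathbb Z$ arising as follows: choose a vertex $v$ of $D^\circ$ and a collection $P$ of finite walks in $D^\circ$ starting at $v$ such that every infinite forwards walk in $D^\circ$ from $v$ begins with precisely one element of $P$; let $S$ be the multiset of end vertices of elements of $P$; let $R$ equal $S$ except that $(v)R=(v)S-1$. $\operatorname{Refine}(D)$ is the submonoid of $(\mathbb Z^{V_{D^\circ}},+)$ generated by all elementary refiners. *)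

(* Defs.v *)
From HB Require Import structures.
From mathcomp Require Import all_boot all_order all_algebra.
From mathcomp Require Import zify.
From mathcomp Require Import boolp classical_sets functions cardinality.

Set Implicit Arguments.
Unset Strict Implicit.
Unset Printing Implicit Defensive.

Import Order.TTheory GRing.Theory Num.Theory.

Local Open Scope classical_set_scope.
Local Open Scope ring_scope.
Local Open Scope quotient_scope.
Local Open Scope card_scope.

Record digraph := Digraph {
  vertex : Type;
  edge : Type;
  source : edge -> vertex;
  target : edge -> vertex }.

Record fdigraph := FDigraph {
  fvertex : finType;
  fedge : finType;
  fsource : fedge -> fvertex;
  ftarget : fedge -> fvertex }.

Coercion digraph_of_fdigraph (D : fdigraph) : digraph :=
  Digraph (@fsource D) (@ftarget D).

Record dhom (D1 D2 : digraph) := DHom {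
  homV : vertex D1 -> vertex D2;
  homE : edge D1 -> edge D2;
  hom_source : forall e, source (homE e) = homV (source e);
  hom_target : forall e, target (homE e) = homV (target e) }.

Lemma hom_eq (D1 D2 : digraph) (h1 h2 : dhom D1 D2) :
  homV h1 =1 homV h2 -> homE h1 =1 homE h2 -> h1 = h2.
Proof.
case: h1 h2 => [v1 e1 s1 t1] [v2 e2 s2 t2] /= /funext ev /funext ee.
by subst v2 e2; congr DHom; exact: Prop_irrelevance.
Qed.

(* diagrammatic order: first p, then q *)
Definition hom_comp (D1 D2 D3 : digraph) (p : dhom D1 D2) (q : dhom D2 D3) :
  dhom D1 D3.
Proof.
refine (@DHom D1 D3 (fun x => homV q (homV p x)) (fun e => homE q (homE p e)) _ _).
- by move=> e; rewrite !hom_source.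
- by move=> e; rewrite !hom_target.
Defined.

(* The edge (i, i+1) is represented by its source i. *)
Definition Zitv (I : interval int) : digraph :=
  @Digraph {i : int | i \in I} {i : int | (i \in I) && (i + 1 \in I)}
    (fun e => exist _ (sval e) (proj1 (andP (svalP e))))
    (fun e => exist _ (sval e + 1) (proj2 (andP (svalP e)))).

Definition Zpoint (I : interval int) (i : int) (iI : i \in I) :
  vertex (Zitv I) := exist _ i iI.

Definition Zedge (I : interval int) (i : int) (iI : i \in I)
  (jI : i + 1 \in I) : edge (Zitv I) := exist _ i (introT andP (conj iI jI)).

Definition Zincl (I J : interval int) (sIJ : {subset I <= J}) :
  dhom (Zitv I) (Zitv J).
Proof.
refine (@DHom (Zitv I) (Zitv J)
  (fun x => Zpoint (sIJ _ (svalP x)))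
  (fun e => Zedge (sIJ _ (proj1 (andP (svalP e))))
                  (sIJ _ (proj2 (andP (svalP e))))) _ _).
- by move=> e; exact: val_inj.
- by move=> e; exact: val_inj.
Defined.

Definition restr (D : digraph) (I J : interval int) (sIJ : {subset I <= J})
  (h : dhom (Zitv J) D) : dhom (Zitv I) D := hom_comp (Zincl sIJ) h.

Definition Zseg (n : nat) : interval int := `[0, n%:Z].
Definition Zfwd : interval int := `[0, +oo[.
Definition Zbwd (n : int) : interval int := `]-oo, n].
Definition Zfull : interval int := `]-oo, +oo[.

Lemma in_Zfull (i : int) : i \in Zfull.
Proof. by rewrite in_itv. Qed.

Lemma in_Zbwd (n i : int) : (i \in Zbwd n) = (i <= n).
Proof. by rewrite in_itv. Qed.

Lemma in_Zfwd (i : int) : (i \in Zfwd) = (0 <= i).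
Proof. by rewrite in_itv /= andbT. Qed.

Lemma in_Zseg (n : nat) (i : int) : (i \in Zseg n) = (0 <= i <= n%:Z).
Proof. by rewrite in_itv. Qed.

Lemma sub_Zfull (I : interval int) : {subset I <= Zfull}.
Proof. by move=> i _; exact: in_Zfull. Qed.

Lemma sub_Zseg_fwd (n : nat) : {subset Zseg n <= Zfwd}.
Proof. by move=> i; rewrite in_Zseg in_Zfwd => /andP[]. Qed.

Lemma Zseg_first (n : nat) : 0 \in Zseg n.
Proof. by rewrite in_Zseg; lia. Qed.

Lemma Zseg_last (n : nat) : n%:Z \in Zseg n.
Proof. by rewrite in_Zseg; lia. Qed.

Lemma Zfwd0 : 0 \in Zfwd.
Proof. by rewrite in_Zfwd. Qed.

Lemma Zbwd_last (n : int) : n \in Zbwd n.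
Proof. by rewrite in_Zbwd. Qed.

Definition biwalk (D : digraph) := dhom (Zitv Zfull) D.
Definition fwalk (D : digraph) := dhom (Zitv Zfwd) D.
Definition bwalk (D : digraph) := dhom (Zitv (Zbwd 0)) D.
Definition finwalk (D : digraph) := {n : nat & dhom (Zitv (Zseg n)) D}.

Definition bivertex (D : digraph) (w : biwalk D) (i : int) : vertex D :=
  homV w (Zpoint (in_Zfull i)).
Definition biedge (D : digraph) (w : biwalk D) (i : int) : edge D :=
  homE w (Zedge (in_Zfull i) (in_Zfull (i + 1))).

Definition fwalk_start (D : digraph) (h : fwalk D) : vertex D :=
  homV h (Zpoint Zfwd0).
Definition bwalk_end (D : digraph) (h : bwalk D) : vertex D :=
  homV h (Zpoint (Zbwd_last 0)).

Definition finwalk_start (D : digraph) (p : finwalk D) : vertex D :=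
  homV (projT2 p) (Zpoint (Zseg_first (projT1 p))).
Definition finwalk_end (D : digraph) (p : finwalk D) : vertex D :=
  homV (projT2 p) (Zpoint (Zseg_last (projT1 p))).

Definition begins_with (D : digraph) (h : fwalk D) (p : finwalk D) : Prop :=
  restr (@sub_Zseg_fwd (projT1 p)) h = projT2 p.

Definition is_udaf (D : fdigraph) : Prop :=
  forall v : fvertex D,
    ~ (exists! h : fwalk D, fwalk_start h = v) /\
    ~ (exists! h : bwalk D, bwalk_end h = v).

Record udaf := UDAF { udaf_digraph :> fdigraph; udafP : is_udaf udaf_digraph }.

Arguments udafP : clear implicits.

Definition coreV (D : fdigraph) : set (fvertex D) :=
  [set v | exists (h : biwalk D) (i : int), bivertex h i = v].
Definition coreE (D : fdigraph) : set (fedge D) :=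
  [set e | exists (h : biwalk D) (i : int), biedge h i = e].

Arguments coreV : clear implicits.
Arguments coreE : clear implicits.

Lemma core_source (D : fdigraph) (e : fedge D) :
  e \in coreE D -> fsource e \in coreV D.
Proof.
rewrite !inE => -[h [i <-]]; exists h, i.
rewrite /bivertex /biedge; apply: etrans; last exact/esym/(hom_source h).
by congr homV; exact: val_inj.
Qed.

Lemma core_target (D : fdigraph) (e : fedge D) :
  e \in coreE D -> ftarget e \in coreV D.
Proof.
rewrite !inE => -[h [i <-]]; exists h, (i + 1).
rewrite /bivertex /biedge; apply: etrans; last exact/esym/(hom_target h).
by congr homV; exact: val_inj.
Qed.

Definition core (D : fdigraph) : fdigraph :=
  @FDigraph {v : fvertex D | v \in coreV D} {e : fedge D | e \in coreE D}
    (fun e => exist _ (fsource (sval e)) (core_source (svalP e)))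
    (fun e => exist _ (ftarget (sval e)) (core_target (svalP e))).

Definition Adj (D : fdigraph) (v w : fvertex D) : nat :=
  #|[pred e : fedge D | (fsource e == v) && (ftarget e == w)]|.

Definition Rel (D : fdigraph) (v w : fvertex D) : int :=
  (Adj v w)%:Z - (v == w)%:Z.

Definition rational (D : digraph) (w : bwalk D) : Prop :=
  exists n m : int, [/\ n <= 0, m <= -1,
    forall a b : vertex (Zitv (Zbwd 0)),
      sval a < n -> sval b = sval a + m -> homV w a = homV w b &
    forall a b : edge (Zitv (Zbwd 0)),
      sval a < n -> sval b = sval a + m -> homE w a = homE w b].

Definition irrational_past (D : digraph) (w : biwalk D) : Prop :=
  ~ rational (restr (@sub_Zfull (Zbwd 0)) w).

(* the power sigma^k of the automorphism sigma : i |-> i + 1 *)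
Definition shift (k : int) : dhom (Zitv Zfull) (Zitv Zfull).
Proof.
refine (@DHom (Zitv Zfull) (Zitv Zfull)
  (fun x => Zpoint (in_Zfull (sval x + k)))
  (fun e => Zedge (in_Zfull (sval e + k)) (in_Zfull (sval e + k + 1))) _ _).
- by move=> e; exact: val_inj.
- by move=> e; apply: val_inj; rewrite /= addrAC.
Defined.

Definition shift_orbit (D : digraph) (h : biwalk D) : set (biwalk D) :=
  range (fun k : int => hom_comp (shift k) h).

Definition ray (D : digraph) (w : biwalk D) (n : int) : set (biwalk D) :=
  [set h | restr (@sub_Zfull (Zbwd n)) h = restr (@sub_Zfull (Zbwd n)) w].

Definition uray (D : digraph) (w : biwalk D) (n : int) :
  set (set (biwalk D)) := (@shift_orbit D) @` ray w n.

Definition uray_with_central_vertex (D : digraph) (X : set (set (biwalk D)))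
  (v : vertex D) : Prop :=
  exists (w : biwalk D) (n : int),
    [/\ irrational_past w, X = uray w n & bivertex w n = v].

Definition is_uray (D : digraph) (X : set (set (biwalk D))) : Prop :=
  exists v : vertex D, uray_with_central_vertex X v.

Definition is_ubeam (D : digraph) (B : set (set (biwalk D))) : Prop :=
  exists (k : nat) (X : 'I_k -> set (set (biwalk D))),
    (forall i, is_uray (X i)) /\ B = \bigcup_i X i.

Definition vertex_count (D : fdigraph) (M : {ffun fvertex (core D) -> nat})
  (B : set (set (biwalk D))) : Prop :=
  exists (k : nat) (X : 'I_k -> set (set (biwalk D))) (c : 'I_k -> fvertex D),
    [/\ forall i, uray_with_central_vertex (X i) (c i),
        trivIset setT X,
        B = \bigcup_i X i &
        forall v, M v = #|[pred i | c i == sval v]|].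

Definition is_equivalence (A : Type) (S : set (A * A)) : Prop :=
  [/\ forall a, S (a, a),
      forall a b, S (a, b) -> S (b, a) &
      forall a b c, S (a, b) -> S (b, c) -> S (a, c)].

Definition is_congruence (A : nmodType) (S : set (A * A)) : Prop :=
  is_equivalence S /\
  forall a b c d, S (a, b) -> S (c, d) -> S (a + c, b + d).

Record congruence (A : nmodType) := Congruence {
  congr_rel : set (A * A);
  congrP : is_congruence congr_rel }.

Definition congr_bool (A : nmodType) (r : congruence A) : rel A :=
  fun a b => `[< congr_rel r (a, b) >].

Lemma congr_bool_refl (A : nmodType) (r : congruence A) :
  reflexive (congr_bool r).
Proof. by case: (congrP r) => -[R S T] _ a; apply/asboolP. Qed.

Lemma congr_bool_sym (A : nmodType) (r : congruence A) :
  symmetric (congr_bool r).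
Proof.
case: (congrP r) => -[R S T] _ a b.
by apply/asboolP/asboolP; exact: S.
Qed.

Lemma congr_bool_trans (A : nmodType) (r : congruence A) :
  transitive (congr_bool r).
Proof.
case: (congrP r) => -[R S T] _ b a c /asboolP ab /asboolP bc.
by apply/asboolP; exact: T ab bc.
Qed.

Canonical congr_equiv (A : nmodType) (r : congruence A) :=
  EquivRel (congr_bool r) (congr_bool_refl r) (congr_bool_sym r)
    (@congr_bool_trans A r).

Definition quot_monoid (A : nmodType) (r : congruence A) : Type :=
  {eq_quot congr_equiv r}.

HB.instance Definition _ (A : nmodType) (r : congruence A) :=
  EqQuotient.on (quot_monoid r).
HB.instance Definition _ (A : nmodType) (r : congruence A) :=
  Choice.on (quot_monoid r).

Definition quot_class (A : nmodType) (r : congruence A) (a : A) :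
  quot_monoid r := \pi_(quot_monoid r) a.

Lemma quot_classP (A : nmodType) (r : congruence A) (a b : A) :
  quot_class r a = quot_class r b <-> congr_rel r (a, b).
Proof.
rewrite /quot_class; split.
  by move/eqquotP => /asboolP.
by move=> ab; apply/eqquotP/asboolP.
Qed.

Definition quot_add (A : nmodType) (r : congruence A) (x y : quot_monoid r) :
  quot_monoid r := quot_class r (repr x + repr y).

Lemma quot_class_repr (A : nmodType) (r : congruence A) (x : quot_monoid r) :
  quot_class r (repr x) = x.
Proof. by rewrite /quot_class reprK. Qed.

Lemma quot_addE (A : nmodType) (r : congruence A) (a b : A) :
  quot_add (quot_class r a) (quot_class r b) = quot_class r (a + b).
Proof.
apply/quot_classP; apply: (proj2 (congrP r));
  by apply/quot_classP; rewrite quot_class_repr.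
Qed.

Lemma quot_addA (A : nmodType) (r : congruence A) :
  associative (@quot_add A r).
Proof.
move=> x y z; rewrite -(quot_class_repr x) -(quot_class_repr y).
by rewrite -(quot_class_repr z) !quot_addE addrA.
Qed.

Lemma quot_addC (A : nmodType) (r : congruence A) :
  commutative (@quot_add A r).
Proof.
move=> x y; rewrite -(quot_class_repr x) -(quot_class_repr y).
by rewrite !quot_addE addrC.
Qed.

Lemma quot_add0 (A : nmodType) (r : congruence A) :
  left_id (quot_class r 0) (@quot_add A r).
Proof.
by move=> x; rewrite -(quot_class_repr x) quot_addE add0r.
Qed.

HB.instance Definition _ (A : nmodType) (r : congruence A) :=
  GRing.isNmodule.Build (quot_monoid r)
    (@quot_addA A r) (@quot_addC A r) (@quot_add0 A r).

Lemma smallest_congruence (A : nmodType) (R : set (A * A)) :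
  is_congruence (smallest (@is_congruence A) R).
Proof.
split; first split.
- by move=> a S [[[Sr _ _] _] _]; exact: Sr.
- move=> a b ab S SR; have Sab := ab S SR.
  by case: SR => [[[_ Ss _] _] _]; exact: Ss.
- move=> a b c ab bc S SR; have Sab := ab S SR; have Sbc := bc S SR.
  by case: SR => [[[_ _ St] _] _]; exact: St Sab Sbc.
- move=> a b c d ab cd S SR; have Sab := ab S SR; have Scd := cd S SR.
  by case: SR => [[_ Sadd] _]; exact: Sadd.
Qed.

Lemma smallest_equivalence (A : Type) (R : set (A * A)) :
  is_equivalence (smallest (@is_equivalence A) R).
Proof.
split.
- by move=> a S [[Sr _ _] _]; exact: Sr.
- move=> a b ab S SR; have Sab := ab S SR.
  by case: SR => [[_ Ss _] _]; exact: Ss.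
- move=> a b c ab bc S SR; have Sab := ab S SR; have Sbc := bc S SR.
  by case: SR => [[_ _ St] _]; exact: St Sab Sbc.
Qed.

(* {ffun X -> nat} is the free commutative monoid on the finite set X. *)
Definition free_gen (X : finType) (x : X) : {ffun X -> nat} :=
  [ffun y => (x == y : nat)].

Definition generated_congruence (X : finType)
  (R : set ({ffun X -> nat} * {ffun X -> nat})) :
  congruence {ffun X -> nat} := Congruence (smallest_congruence R).

Definition presented_monoid (X : finType)
  (R : set ({ffun X -> nat} * {ffun X -> nat})) : nmodType :=
  quot_monoid (generated_congruence R).

Definition presented_gen (X : finType)
  (R : set ({ffun X -> nat} * {ffun X -> nat})) (x : X) :
  presented_monoid R := quot_class (generated_congruence R) (free_gen x).

Definition is_submonoid (A : nmodType) (S : set A) : Prop :=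
  S 0 /\ forall a b, S a -> S b -> S (a + b).

Definition generated_submonoid (A : nmodType) (G : set A) : set A :=
  smallest (@is_submonoid A) G.

Definition common_beam (D : fdigraph) :
  set ({ffun fvertex (core D) -> nat} * {ffun fvertex (core D) -> nat}) :=
  [set M | exists B, [/\ is_ubeam B, vertex_count M.1 B & vertex_count M.2 B]].

Arguments common_beam : clear implicits.

Definition dim_rel (D : fdigraph) :
  set ({ffun fvertex (core D) -> nat} * {ffun fvertex (core D) -> nat}) :=
  smallest (@is_equivalence {ffun fvertex (core D) -> nat}) (common_beam D).

Arguments dim_rel : clear implicits.

(* A backward walk ending at u, as its sequence of edges read backwards:
   s k is the edge from -(k + 1) to -k. *)
Definition back_seq (D : digraph) (u : vertex D) (s : nat -> edge D) : Prop :=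
  target (s 0%N) = u /\ forall k, target (s k.+1) = source (s k).

Lemma back_seq_bwalk (D : digraph) (u : vertex D) (s : nat -> edge D) :
  back_seq u s -> exists h : bwalk D,
    bwalk_end h = u /\ forall e, homE h e = s (absz (sval e + 1)%R).
Proof.
move=> [s0 sS].
pose f (x : vertex (Zitv (Zbwd 0))) : vertex D :=
  if sval x == 0 then u else source (s (absz (sval x + 1)%R)).
pose g (e : edge (Zitv (Zbwd 0))) : edge D := s (absz (sval e + 1)%R).
have lt0 (e : edge (Zitv (Zbwd 0))) : sval e < 0.
  by have /andP[_] := svalP e; rewrite in_Zbwd; lia.
have fs e : source (g e) = f (source e).
  by rewrite /f /g /=; have := lt0 e; case: eqP => // ->.
have ft e : target (g e) = f (target e).
  rewrite /f /g /=; have := lt0 e; case: eqP => [-> //|].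
  move: (sval e) => z ne z0.
  have -> : absz (z + 1)%R = (absz (z + 1 + 1)%R).+1 by lia.
  exact: sS.
by exists (DHom fs ft); split.
Qed.

Lemma bwalk_back_seq (D : digraph) (h : bwalk D) : exists s,
  back_seq (bwalk_end h) s /\ forall e, homE h e = s (absz (sval e + 1)%R).
Proof.
have i1 (k : nat) : - k.+1%:Z \in Zbwd 0 by rewrite in_Zbwd; lia.
have i2 (k : nat) : - k.+1%:Z + 1 \in Zbwd 0 by rewrite in_Zbwd; lia.
exists (fun k => homE h (Zedge (i1 k) (i2 k))); split; first split.
- by rewrite hom_target /bwalk_end; congr homV; apply: val_inj => /=; lia.
- move=> k; rewrite hom_source hom_target; congr homV.
  by apply: val_inj => /=; lia.
- move=> e; congr homE; apply: val_inj => /=.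
  have /andP[_] := svalP e; rewrite in_Zbwd.
  by move: (sval e) => z; lia.
Qed.

Lemma back_seq_branch (D : fdigraph) (u : vertex D) (s : nat -> edge D) :
  is_udaf D -> back_seq u s ->
  exists t k, back_seq u t /\ t k <> s k.
Proof.
move=> ud us; apply: contrapT => nex; case: (ud u) => _; apply.
have [h [hu hE]] := back_seq_bwalk us.
exists h; split => // g gu.
have [t [ut gE]] := bwalk_back_seq g.
rewrite gu in ut.
have ts k : t k = s k.
  by apply: contrapT => ne; apply: nex; exists t, k.
have EE e : homE h e = homE g e by rewrite hE gE ts.
apply: hom_eq => // x.
have [x0|x0] := eqVneq (sval x) 0.
  have -> : x = Zpoint (Zbwd_last 0) by exact: val_inj.
  by rewrite -/(bwalk_end h) -/(bwalk_end g) hu gu.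
have ix := svalP x.
have ix1 : sval x + 1 \in Zbwd 0.
  by move: ix x0; rewrite !in_Zbwd; lia.
have -> : x = source (Zedge ix ix1) by exact: val_inj.
by rewrite -!hom_source EE.
Qed.

Lemma back_seq_splice (D : digraph) (u : vertex D) (s t : nat -> edge D) n :
  back_seq u s -> back_seq (target (s n)) t ->
  back_seq u (fun k => if (k < n)%N then s k else t (k - n)%N).
Proof.
move=> [s0 sS] [t0 tS]; split.
  by case: n t0 => [|n] t0 /=; rewrite ?t0.
move=> k; have [kn|nk|kn] := ltngtP k.+1 n.
- exact: sS.
- by rewrite subSn.
- by rewrite -[in (k.+1 - n)%N]kn subnn t0 -kn sS.
Qed.

Lemma back_seq_drop (D : digraph) (u : vertex D) (s : nat -> edge D) n :
  back_seq u s -> back_seq (target (s n)) (fun k => s (n + k)%N).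
Proof. by move=> [s0 sS]; split => [|k]; rewrite ?addn0 // addnS. Qed.

(* Given a countable family b of edge sequences, some backward walk to u
   avoids all of them. *)
Lemma back_seq_diagonal (D : fdigraph) (u : vertex D) (s0 : nat -> edge D)
  (b : nat -> nat -> edge D) :
  is_udaf D -> back_seq u s0 ->
  exists s, back_seq u s /\ forall j, exists k, s k <> b j k.
Proof.
move=> ud us0.
pose T := ((nat -> edge D) * nat)%type.
have step (a : nat * T) : exists c : T,
    back_seq u a.2.1 ->
    [/\ back_seq u c.1, (a.2.2 < c.2)%N,
        forall k, (k < a.2.2)%N -> c.1 k = a.2.1 k &
        exists2 k, (k < c.2)%N & c.1 k <> b a.1 k].
  case: a => j [s n] /=.
  have [us|] := pselect (back_seq u s); last by exists (s, n).
  have [[k ne]|all_eq] := pselect (exists k, s k <> b j k).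
    exists (s, (maxn n k).+1) => _; split => //=; first by lia.
    by exists k => //; lia.
  have bs k : b j k = s k.
    by apply: contrapT => ne; apply: all_eq; exists k => /esym.
  have [t [k [ut ne]]] := back_seq_branch ud (back_seq_drop n us).
  exists (fun k => if (k < n)%N then s k else t (k - n)%N, (n + k).+1) => _.
  split => /=.
  - exact: back_seq_splice.
  - by lia.
  - by move=> i ->.
  - exists (n + k)%N => //.
    by rewrite ltnNge leq_addr /= addKn bs.
have [F FP] := choice step.
pose f := fix f j : T := if j is i.+1 then F (i, f i) else (s0, 0%N).
have fb j : back_seq u (f j).1.
  by elim: j => //= j IH; have [] := FP (j, f j) IH.
have fS j := FP (j, f j) (fb j).
have f_ge j : (j <= (f j).2)%N.
  by elim: j => //= j IH; have [_ /= lt _ _] := fS j; exact: leq_ltn_trans lt.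
have f_mono i j : (i <= j)%N -> ((f i).2 <= (f j).2)%N.
  elim: j => [|j IH]; first by rewrite leqn0 => /eqP->.
  rewrite leq_eqVlt => /orP[/eqP-> //|]; rewrite ltnS => /IH le.
  by have [_ /= lt _ _] := fS j; apply: leq_trans le (ltnW lt).
have f_agree i j k : (i <= j)%N -> (k < (f i).2)%N -> (f j).1 k = (f i).1 k.
  elim: j => [|j IH]; first by rewrite leqn0 => /eqP->.
  rewrite leq_eqVlt => /orP[/eqP-> //|]; rewrite ltnS => le lt.
  have [_ _ /= ag _] := fS j; rewrite ag ?IH //.
  exact: leq_trans lt (f_mono _ _ le).
have lim i k : (k < (f i).2)%N -> (f k.+1).1 k = (f i).1 k.
  move=> lt; have [le|le] := leqP i k.+1; first exact: f_agree.
  by apply/esym/f_agree; [exact: ltnW | exact: f_ge].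
exists (fun k => (f k.+1).1 k); split; first split.
- by have [] := fb 1%N.
- move=> k; cbv beta; rewrite (lim k.+2 k); last by have := f_ge k.+2; lia.
  by have [_] := fb k.+2.
- move=> j; have [_ _ _ [k /= lt ne]] := fS j.
  by exists k; rewrite (lim j.+1).
Qed.

Lemma biwalk_of_edges (D : digraph) (e : int -> edge D) :
  (forall i, target (e i) = source (e (i + 1))) ->
  exists h : biwalk D, (forall x, homE h x = e (sval x)) /\
    forall x, homV h x = source (e (sval x)).
Proof.
move=> chain.
pose f (y : vertex (Zitv Zfull)) : vertex D := source (e (sval y)).
pose g (y : edge (Zitv Zfull)) : edge D := e (sval y).
have hs x : source (g x) = f (source x) by [].
have ht x : target (g x) = f (target x) by exact: chain.
by exists (DHom hs ht).
Qed.

Lemma biedgeE (D : digraph) (h : biwalk D) e : homE h e = biedge h (sval e).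
Proof. by congr homE; exact: val_inj. Qed.

Lemma bivertexE (D : digraph) (h : biwalk D) x : homV h x = bivertex h (sval x).
Proof. by congr homV; exact: val_inj. Qed.

Lemma ray_edge (D : digraph) (w h : biwalk D) (n i : int) :
  ray w n h -> i < n -> biedge h i = biedge w i.
Proof.
move=> hw lt.
have i1 : i \in Zbwd n by rewrite in_Zbwd ltW.
have i2 : i + 1 \in Zbwd n by rewrite in_Zbwd; lia.
have /(congr1 (fun g => homE g (Zedge i1 i2))) /= := hw.
by rewrite !biedgeE.
Qed.

(* A fresh ray: irrational past, given central vertex, disjoint from a given
   finite family of rays. *)
Lemma fresh_ray (D : fdigraph) (u : fvertex D) (m : nat)
  (w : 'I_m -> biwalk D) (n : 'I_m -> int) :
  is_udaf D -> coreV D u ->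
  exists x : biwalk D, [/\ irrational_past x, bivertex x 0 = u &
    forall i, uray x 0 `&` uray (w i) (n i) = set0].
Proof.
move=> ud [g [p gp]].
pose s0 k := biedge g (p - 1 - k%:Z).
have gS q : target (biedge g q) = source (biedge g (q + 1)).
  by rewrite hom_source hom_target; congr homV; exact: val_inj.
have sg q : source (biedge g q) = bivertex g q.
  by rewrite hom_source; congr homV; exact: val_inj.
have us0 : back_seq (u : vertex D) s0.
  split=> [|k]; rewrite /s0 gS; last by do 2!f_equal; lia.
  by rewrite sg -gp; f_equal; lia.
pose T := (seq (fedge D) * (seq (fedge D) + 'I_m * int))%type.
pose tail (a : seq (fedge D) + 'I_m * int) (k : nat) : edge D :=
  match a with
  | inl l => nth (s0 0%N) l (k %% size l)
  | inr (i, c) => biedge (w i) (c - k%:Z)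
  end.
pose bad (a : T) (k : nat) : edge D :=
  if (k < size a.1)%N then nth (s0 0%N) a.1 k else tail a.2 (k - size a.1)%N.
pose b j := if unpickle j is Some a then bad a else s0.
have [s [us sb]] := back_seq_diagonal b ud us0.
have s_good (a : T) : exists k, s k <> bad a k.
  by have := sb (pickle a); rewrite /b pickleK.
have s_tail (j : nat) a : exists k, s (j + k)%N <> tail a k.
  have [k] := s_good (mkseq s j, a); rewrite /bad /= size_mkseq.
  case: ltnP => kj; first by rewrite nth_mkseq.
  by exists (k - j)%N; rewrite subnKC.
pose e (i : int) : edge D := if i < 0 then s (absz (i + 1)%R) else biedge g (p + i).
have [i|x [xE xV]] := @biwalk_of_edges D e.
  rewrite /e; have [us_0 usS] := us.
  case: ltrP => i0; case: ltrP => i1.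
  - have -> : absz (i + 1)%R = (absz (i + 1 + 1)%R).+1 by lia.
    exact: usS.
  - have -> : i = -1 by lia.
    by rewrite us_0 sg -gp; f_equal; lia.
  - by lia.
  - by rewrite gS addrA.
have xe (i : int) : biedge x i = e i by rewrite /biedge xE.
have xs (k : nat) : biedge x (- k%:Z - 1) = s k.
  rewrite xe /e; case: ltrP => //; last by lia.
  by move=> _; f_equal; lia.
exists x; split.
- move=> [a [q [a0 q0 _ per]]].
  have sperE (k : nat) : (absz a <= k)%N -> s (k + absz q)%N = s k.
    move=> ak; rewrite -!xs.
    have i1 (z : int) : z < 0 -> z \in Zbwd 0 by rewrite in_Zbwd; lia.
    have i2 (z : int) : z < 0 -> z + 1 \in Zbwd 0 by rewrite in_Zbwd; lia.
    have n1 : - k%:Z - 1 < 0 by lia.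
    have n2 : - (k + absz q)%N%:Z - 1 < 0 by lia.
    have := per (Zedge (i1 _ n1) (i2 _ n1)) (Zedge (i1 _ n2) (i2 _ n2)).
    by rewrite /= !biedgeE /= => -> //; lia.
  have sperM (k r : nat) : (absz a <= k)%N -> s (k + r * absz q)%N = s k.
    move=> ak; elim: r => [|r IH]; first by rewrite addn0.
    by rewrite mulSn (addnC (absz q)) addnA sperE // (leq_trans ak) ?leq_addr.
  have [k] := s_tail (absz a) (inl (mkseq (fun k => s (absz a + k)%N) (absz q))).
  apply; rewrite /tail size_mkseq nth_mkseq; last by rewrite ltn_mod; lia.
  rewrite -(sperM (absz a + k %% absz q)%N (k %/ absz q)%N) ?leq_addr //.
  by rewrite -addnA (addnC (k %% _)%N) -divn_eq.
- have -> : bivertex x 0 = source (e 0) by rewrite /bivertex xV.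
  by rewrite /e ltxx addr0 sg.
- move=> i; apply: contrapT => /eqP/set0P[X [[h hx hX] [h' hw hX']]].
  have : shift_orbit h h.
    exists 0 => //; apply: hom_eq => y /=.
      by rewrite !bivertexE /= addr0.
    by rewrite !biedgeE /= addr0.
  rewrite hX -hX' => -[c _ ch].
  have hc (j : int) : biedge h j = biedge h' (j + c).
    by rewrite -ch /biedge /= biedgeE.
  pose N := absz (n i - c)%R.
  have [k] := s_tail N (inr (i, - N%:Z - 1 + c)).
  apply; rewrite -xs -(ray_edge hx); last by lia.
  rewrite hc (ray_edge hw); last by rewrite /N; lia.
  by rewrite /tail; f_equal; lia.
Qed.

Lemma vertex_count_ubeam (D : fdigraph) M (B : set (set (biwalk D))) :
  vertex_count M B -> is_ubeam B.
Proof.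
move=> [k [X [c [Xc _ BX _]]]]; exists k, X; split => // i.
by exists (c i).
Qed.

Lemma ubeam_fresh_ray (D : fdigraph) (B : set (set (biwalk D)))
  (u : fvertex D) :
  is_udaf D -> coreV D u -> is_ubeam B ->
  exists Y : set (set (biwalk D)), uray_with_central_vertex Y u /\ Y `&` B = set0.
Proof.
move=> ud uc [k [X [Xr ->]]].
have {}Xr i : exists wn : biwalk D * int, X i = uray wn.1 wn.2.
  by have [v [w [n [_ -> _]]]] := Xr i; exists (w, n).
have [f fP] := choice Xr.
have [x [xi xu xd]] := fresh_ray (fun i => (f i).1) (fun i => (f i).2) ud uc.
exists (uray x 0); split; first by exists x, 0.
by rewrite setI_bigcupr; apply: bigcup0 => i _; rewrite fP.
Qed.

Lemma vertex_count_add (D : fdigraph) M (B Y : set (set (biwalk D)))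
  (u : fvertex (core D)) :
  uray_with_central_vertex Y (sval u) -> Y `&` B = set0 ->
  vertex_count M B -> vertex_count (M + free_gen u) (Y `|` B).
Proof.
move=> Yu YB [k [X [c [Xc Xd BX Mc]]]].
exists k.+1, (fun i => oapp X Y (unlift ord0 i)),
  (fun i => oapp c (sval u) (unlift ord0 i)).
have YX i : Y `&` X i = set0.
  by apply/seteqP; split => // z [Yz Xz]; rewrite -YB BX; split => //; exists i.
split.
- by move=> i; case: (unlift ord0 i) => [j|] /=.
- apply/trivIsetP => i j _ _.
  case: unliftP => [i'|] ->; case: unliftP => [j'|] -> //= ne.
  + by move/trivIsetP: Xd; apply => //; apply: contra ne => /eqP->.
  + by rewrite setIC.
- rewrite BX; apply/seteqP; split => z.
    case => [Yz|[i _ Xz]]; first by exists ord0 => //; rewrite unlift_none.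
    by exists (lift ord0 i) => //; rewrite liftK.
  by case=> i _; case: unliftP => [j|] _ /= zX; [right; exists j | left].
- move=> v; rewrite !ffunE Mc -!sum1_card [in RHS]big_mkcond big_ord_recl.
  rewrite [in LHS]big_mkcond.
  rewrite addrC /=; congr (_ + _)%N.
    by rewrite inE unlift_none -val_eqE; case: eqP.
  by apply: eq_bigr => i _; rewrite !inE liftK.
Qed.

Lemma free_gen_ind (X : finType) (P : {ffun X -> nat} -> Prop) :
  P 0 -> (forall M x, P M -> P (M + free_gen x)) -> forall M, P M.
Proof.
move=> P0 PS M; have [n] := ubnP (\sum_x M x); elim: n M => // n IH M lt.
have [[x Mx]|all0] := pselect (exists x, M x <> 0%N); last first.
  suff -> : M = 0 by [].
  apply/ffunP => x; rewrite ffunE; apply: contrapT => Mx.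
  by apply: all0; exists x.
pose N : {ffun X -> nat} := [ffun y => (M y - (x == y))%N].
have MN : M = N + free_gen x.
  by apply/ffunP => y; rewrite !ffunE; case: eqP => [<-|_]; lia.
rewrite MN; apply/PS/IH; move: lt.
have -> : (\sum_y M y = (\sum_y N y).+1)%N; last by [].
rewrite (bigD1 x) //= [in RHS](bigD1 x) //=.
have -> : M x = (N x).+1 by rewrite ffunE eqxx; lia.
rewrite addSn.
congr (_ + _).+1; apply: eq_bigr => y /negPf ne.
by rewrite ffunE eq_sym ne subn0.
Qed.

Lemma dim_rel_congruence (D : udaf) : is_congruence (dim_rel D).
Proof.
have eqv := smallest_equivalence (common_beam D).
split=> //; rewrite -/(dim_rel D) in eqv; case: eqv => Dr Ds Dt.
have addu (M1 M2 : {ffun fvertex (core D) -> nat}) u :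
    common_beam D (M1, M2) -> common_beam D (M1 + free_gen u, M2 + free_gen u).
  move=> [B /= [Bb B1 B2]].
  have uc : coreV D (sval u) by apply/set_mem/(svalP u).
  have [Y [Yu YB]] := ubeam_fresh_ray (udafP D) uc Bb.
  have C1 := vertex_count_add Yu YB B1; have C2 := vertex_count_add Yu YB B2.
  by exists (Y `|` B); split => //; exact: vertex_count_ubeam C1.
have addN (M1 M2 N : {ffun fvertex (core D) -> nat}) :
    common_beam D (M1, M2) -> common_beam D (M1 + N, M2 + N).
  move=> M12; elim/free_gen_ind: N => [|N u IH]; first by rewrite !addr0.
  by rewrite !addrA; exact: addu.
have addD N (M1 M2 : {ffun fvertex (core D) -> nat}) :
    dim_rel D (M1, M2) -> dim_rel D (M1 + N, M2 + N).
  move=> M12.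
  apply: (M12 [set M | dim_rel D (M.1 + N, M.2 + N)]); split.
    split=> [a|a b|a b c]; [exact: Dr | exact: Ds | exact: Dt].
  by move=> [a b] ab S [_]; apply; exact: addN.
move=> a b c d ab cd; apply: (Dt _ (b + c)); first exact: addD.
by rewrite !(addrC b); exact: addD.
Qed.

Definition dim_congruence (D : udaf) :
  congruence {ffun fvertex (core D) -> nat} :=
  Congruence (dim_rel_congruence D).

Definition udaf_dim_monoid (D : udaf) : nmodType :=
  quot_monoid (dim_congruence D).

Definition dim_gen (D : udaf) (v : fvertex (core D)) : udaf_dim_monoid D :=
  quot_class (dim_congruence D) (free_gen v).

Arguments dim_gen : clear implicits.

Definition adj_relations (C : fdigraph) :
  set ({ffun fvertex C -> nat} * {ffun fvertex C -> nat}) :=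
  range (fun v : fvertex C =>
    (free_gen v, \sum_(w : fvertex C) free_gen w *+ Adj v w)).

Arguments adj_relations : clear implicits.

(* Finiteness of P is not imposed, only that the multiset S of end vertices
   has finite multiplicities. *)
Definition elementary_refiner (C : fdigraph) : set {ffun fvertex C -> int} :=
  [set R | exists (v : fvertex C) (P : set (finwalk C))
                  (S : {ffun fvertex C -> nat}),
    [/\ forall p, P p -> finwalk_start p = v,
        forall h : fwalk C, fwalk_start h = v ->
          exists! p, P p /\ begins_with h p,
        forall u, [set p | P p /\ finwalk_end p = u] #= `I_(S u) &
        forall u, R u = (S u)%:Z - (u == v)%:Z]].

Arguments elementary_refiner : clear implicits.

Definition Refine (D : fdigraph) : set {ffun fvertex (core D) -> int} :=
  generated_submonoid (elementary_refiner (core D)).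

Arguments Refine : clear implicits.

Definition Rel_row (C : fdigraph) (v : fvertex C) : {ffun fvertex C -> int} :=
  [ffun w => Rel v w].

(* Main.v *)
From HB Require Import structures.
Require Import Defs.
From mathcomp Require Import all_boot all_order all_algebra.
From mathcomp Require Import zify.
From mathcomp Require Import boolp classical_sets functions cardinality.

(** Both claims rest on one combinatorial fact about finite trees of walks.
    Starting from a vertex [v], replace repeatedly one vertex by the targets of
    its out-edges; call the multisets obtained in this way the expansions of
    [v].  Each replacement is one application of a defining relation of the
    presented monoid, so [v] is congruent to its expansions
    ([expansion_congr]); and it adds one row of [Rel], so an expansion minus
    [v] is a sum of rows ([expansion_refiner]).  The fact is that a finite set
    of finite walks from [v] such that every infinite walk from [v] begins with
    exactly one of them is the set of leaves of such a tree
    ([code_expansion]).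

    For the presentation, two vertex counts of one beam come from two
    decompositions of the beam into disjoint rays.  Rays are nested or disjoint
    ([uray_inter]), so the nonempty pairwise intersections are rays again and
    refine both decompositions.  Because pasts are irrational, an orbit meets a
    given indexed ray in at most one walk ([uray_ray]); hence a finite
    decomposition of a ray into sub-rays is the same thing as a complete prefix
    code at its central vertex, and the central vertex of the ray expands to
    those of the sub-rays ([uray_expansion]).  Both counts are therefore
    congruent to the count of the common refinement ([common_beam_congr]).
    Conversely, splitting a ray by its next edge realizes every defining
    relation by a beam ([adj_common_beam]).

    For the refining monoid, the walks of length one from [v] exhibit the row of
    [Rel] at [v] as an elementary refiner ([Rel_row_elementary]), and the walks
    that define any elementary refiner form a complete prefix code, so it is an
    expansion minus its root ([elementary_refiner_expansion]). *)

Set Implicit Arguments.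
Unset Strict Implicit.
Unset Printing Implicit Defensive.

Import Order.TTheory GRing.Theory Num.Theory.

Local Open Scope classical_set_scope.
Local Open Scope ring_scope.

(** * Expansions of a vertex *)

Lemma sum_free_gen_Adj (C : fdigraph) (v : fvertex C) :
  \sum_(w : fvertex C) free_gen w *+ Adj v w =
  \sum_(e : fedge C | fsource e == v) free_gen (ftarget e).
Proof.
rewrite [RHS](partition_big (@ftarget C) predT) //=.
apply: eq_bigr => w _; rewrite /Adj -sumr_const.
by apply: eq_bigr => e /andP[_ /eqP->].
Qed.

(** [expansion v S] says that some finite tree of walks, grown from [v] by
    replacing a leaf by all of its out-edges, has [S] as multiset of end
    vertices of its leaves.  The constructors grow the tree at the root, which
    matches the recursion on the first edge in [code_expansion]. *)
Inductive expansion (C : fdigraph) :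
  fvertex C -> {ffun fvertex C -> nat} -> Prop :=
| expansion_stop v : expansion v (free_gen v)
| expansion_split v (S : fedge C -> {ffun fvertex C -> nat}) :
    (forall e, fsource e = v -> expansion (ftarget e) (S e)) ->
    expansion v (\sum_(e : fedge C | fsource e == v) S e).

Lemma congruence_sum (A : nmodType) (r : set (A * A)) (I : Type) (s : seq I)
    (P : pred I) (F G : I -> A) :
  is_congruence r -> (forall i, P i -> r (F i, G i)) ->
  r (\sum_(i <- s | P i) F i, \sum_(i <- s | P i) G i).
Proof.
move=> [[rr _ _] rD] FG.
by apply: (big_ind2 (fun x y => r (x, y))) => // a b c d; exact: rD.
Qed.

(** Each split of a leaf is one use of a defining relation of the presented
    monoid. *)
Lemma expansion_congr (C : fdigraph) (r : set _) (v : fvertex C) S :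
  is_congruence r -> adj_relations C `<=` r ->
  expansion v S -> r (free_gen v, S).
Proof.
move=> rc radj; elim=> {v S} [v|v S _ IH]; first by case: rc => -[].
have [[_ _ rt] _] := rc; apply: rt; first by apply: radj; exists v.
rewrite sum_free_gen_Adj; apply: congruence_sum => // e /eqP; exact: IH.
Qed.

Lemma submonoid_sum (A : nmodType) (S : set A) (I : Type) (s : seq I)
    (P : pred I) (F : I -> A) :
  is_submonoid S -> (forall i, P i -> S (F i)) -> S (\sum_(i <- s | P i) F i).
Proof. by move=> [S0 SD] FS; apply: big_ind. Qed.

Lemma generated_submonoidP (A : nmodType) (G : set A) :
  is_submonoid (generated_submonoid G).
Proof.
split=> [S [[S0 _] _] //|a b aG bG S GS].
by have [[_ SD] _] := GS; apply: SD; [apply: aG|apply: bG].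
Qed.

(** Each split of a leaf [u] replaces [u] by the targets of its out-edges,
    which changes the multiset of leaves by the row of [Rel] at [u]. *)
Lemma expansion_refiner (C : fdigraph) (v : fvertex C) S :
  expansion v S ->
  generated_submonoid (range (@Rel_row C)) [ffun u => (S u)%:Z - (u == v)%:Z].
Proof.
have gm := generated_submonoidP (range (@Rel_row C)).
elim=> {v S} [v|v S _ IH].
  suff -> : [ffun u => (free_gen v u)%:Z - (u == v)%:Z] = 0 by case: gm.
  by apply/ffunP => u; rewrite !ffunE eq_sym subrr.
pose T e : {ffun fvertex C -> int} :=
  [ffun u => (S e u)%:Z - (u == ftarget e)%:Z].
rewrite [X in generated_submonoid _ X]
  (_ : _ = \sum_(e | fsource e == v) T e + Rel_row v); last first.
  apply/ffunP => u; rewrite !ffunE !sum_ffunE /Rel [v == u]eq_sym addrA.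
  congr (_ - _); under [in RHS]eq_bigr do rewrite ffunE.
  rewrite sumrB (big_morph _ PoszD (erefl 0%:Z)) -[LHS]addr0 -addrA; congr (_ + _).
  rewrite /Adj -sum1_card (big_morph _ PoszD (erefl 0%:Z)).
  rewrite [X in _ + X]big_mkcondr /= addrC; apply/esym/eqP; rewrite subr_eq0; apply/eqP.
  by apply: eq_bigr => e _; rewrite eq_sym; case: eqP.
case: (gm) => _; apply; last by move=> G [_]; apply; exists v.
apply: submonoid_sum => // e /eqP; exact: IH.
Qed.

(** * Complete prefix codes of walks *)

(** Infinite forward walks from [v], written as their edge sequences: this
    form supports removing or prepending an edge without casts. *)
Definition stream (D : digraph) (v : vertex D) (s : nat -> edge D) : Prop :=
  source (s 0%N) = v /\ forall k, target (s k) = source (s k.+1).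

Lemma stream_behead (D : digraph) (v : vertex D) s :
  stream v s -> stream (target (s 0%N)) (fun k => s k.+1).
Proof. by move=> [_ sS]; split => // k; exact: sS. Qed.

Definition scons (E : Type) (e : E) (s : nat -> E) (k : nat) : E :=
  if k is k'.+1 then s k' else e.

Lemma stream_scons (D : digraph) (e : edge D) s :
  stream (target e) s -> stream (source e) (scons e s).
Proof. by move=> [s0 sS]; split => // -[|k] /=; rewrite ?s0. Qed.

Lemma mkseq_scons (E : Type) (e : E) s n :
  mkseq (scons e s) n.+1 = e :: mkseq s n.
Proof. by rewrite /mkseq /= (iotaDl 1 0) -map_comp. Qed.

Definition seq_end (C : fdigraph) (v : fvertex C) (q : seq (fedge C)) :
  fvertex C := last v (map (@ftarget C) q).

Definition begins (E : eqType) (s : nat -> E) (q : seq E) : bool :=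
  mkseq s (size q) == q.

Lemma begins_scons (E : eqType) (e f : E) s q :
  begins (scons e s) (f :: q) = (e == f) && begins s q.
Proof. by rewrite /begins [size _]/= mkseq_scons. Qed.

(** Every infinite walk begins with the empty word, and each code word [q j]
    is extended by some infinite walk; uniqueness along that walk gives
    [j = i]. *)
Lemma code_nil (C : fdigraph) (I : finType) (v : fvertex C) (A : {set I})
    (q : I -> seq (fedge C)) i :
  (forall j, j \in A -> exists s, stream (v : vertex C) s /\ begins s (q j)) ->
  (forall s, stream (v : vertex C) s ->
     exists! j, j \in A /\ begins s (q j)) ->
  i \in A -> q i = [::] -> A = [set i]%SET.
Proof.
move=> qs qA iA qi; apply/setP => j; rewrite inE; apply/idP/eqP => [jA|-> //].
have [s [vs sj]] := qs _ jA; have [k [_ ku]] := qA _ vs.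
by rewrite -(ku j) // -(ku i) //; split => //; rewrite qi.
Qed.

(** A complete prefix code is the set of leaves of a tree of walks.  If the
    empty word is a code word it is the only one and the tree is its root.
    Otherwise the code splits according to first edges, and removing the first
    edge from the words that begin with [e] gives a complete prefix code at the
    target of [e] with shorter words. *)
Lemma code_expansion (C : fdigraph) (I : finType) (d : nat)
    (v : fvertex C) (A : {set I}) (q : I -> seq (fedge C)) :
  (forall u : fvertex C, exists s, stream (u : vertex C) s) ->
  (forall i, i \in A -> (size (q i) <= d)%N) ->
  (forall i, i \in A -> exists s, stream (v : vertex C) s /\ begins s (q i)) ->
  (forall s, stream (v : vertex C) s ->
     exists! i, i \in A /\ begins s (q i)) ->
  expansion v (\sum_(i in A) free_gen (seq_end v (q i))).
Proof.
move=> live; elim: d v A q => [|d IH] v A q qd qs qA;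
    have [[i [iA qi]]|q_ne] := pselect (exists i, i \in A /\ q i = [::]).
- by rewrite (code_nil qs qA iA qi) big_set1 qi; exact: expansion_stop.
- have [s [vs sj]] := live v; have [i [[iA _] _]] := qA _ (conj vs sj).
  by case: q_ne; exists i; split => //; apply: size0nil; have := qd _ iA; lia.
- by rewrite (code_nil qs qA iA qi) big_set1 qi; exact: expansion_stop.
have qcons i : i \in A -> exists e q', [/\ q i = e :: q', fsource e = v &
    exists s, stream (ftarget e : vertex C) s /\ begins s q'].
  move=> iA; have [s [vs]] := qs _ iA.
  case qE: (q i) => [|e q']; first by case: q_ne; exists i.
  have -> : s = scons (s 0%N) (fun k => s k.+1) by apply/funext => -[].
  rewrite begins_scons => /andP[/eqP<- sq']; exists (s 0%N), q'; split => //.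
    by case: vs.
  by exists (fun k => s k.+1); split => //; exact: (stream_behead vs).
(* Sort the code words by their first edge. *)
rewrite (_ : \sum_(i in A) _ = \sum_(e : fedge C | fsource e == v)
  \sum_(i in [set i in A | ohead (q i) == Some e]%SET)
     free_gen (seq_end (ftarget e) (behead (q i)))); last first.
  under [RHS]eq_bigr do rewrite big_mkcond.
  rewrite exchange_big big_mkcond /=; apply: eq_bigr => i _.
  under [in RHS]eq_bigr do rewrite inE.
  case: ifPn => iA; last by rewrite big1.
  have [e [q' [-> /eqP ev _]]] := qcons _ iA.
  rewrite (bigD1 e) //= eqxx big1 ?addr0 // => f /andP[_ fe].
  by case: eqP => // -[ef]; rewrite ef eqxx in fe.
apply: expansion_split => e ev; apply: IH => [i|i|s es].
- by rewrite inE => /andP[/qd + _]; rewrite size_behead; lia.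
- rewrite inE => /andP[/qcons[f [q' [-> _ fs]]]] /eqP[fe]; rewrite -fe; exact: fs.
- have vs : stream (v : vertex C) (scons e s).
    by rewrite -ev; exact: (stream_scons es).
  have eqv i : (i \in A /\ begins (scons e s) (q i)) <->
    (i \in [set i in A | ohead (q i) == Some e]%SET /\ begins s (behead (q i))).
    split=> [[iA]|[]]; rewrite inE.
      have [f [q' [-> _ _]]] := qcons _ iA.
      by rewrite begins_scons iA /= => /andP[/eqP-> ->].
    move=> /andP[iA]; have [f [q' [-> _ _]]] := qcons _ iA.
    by move=> /eqP[->]; rewrite begins_scons iA eqxx.
  have [i [/eqv iP iu]] := qA _ vs.
  by exists i; split => // j /eqv/iu.
Qed.

(** * Shifts and rays *)

Lemma biedge_source (D : digraph) (x : biwalk D) i :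
  source (biedge x i) = bivertex x i.
Proof. by rewrite hom_source; congr homV; exact: val_inj. Qed.

Lemma biedge_target (D : digraph) (x : biwalk D) i :
  target (biedge x i) = bivertex x (i + 1).
Proof. by rewrite hom_target; congr homV; exact: val_inj. Qed.

Lemma biwalk_eq (D : digraph) (x y : biwalk D) :
  (forall i, biedge x i = biedge y i) -> x = y.
Proof.
move=> xy; apply: hom_eq => z; last by rewrite !biedgeE.
by rewrite !bivertexE -!biedge_source xy.
Qed.

Lemma rayP (D : digraph) (w x : biwalk D) n :
  ray w n x <-> forall i, i < n -> biedge x i = biedge w i.
Proof.
split=> [wx i|xw]; first exact: ray_edge.
have nE (e : edge (Zitv (Zbwd n))) : sval e < n.
  by have /andP[_] := svalP e; rewrite in_Zbwd; lia.
apply: hom_eq => z /=; last by rewrite !biedgeE xw //; exact: nE.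
have := svalP z; rewrite !bivertexE /= in_Zbwd => zn.
rewrite -[sval z](subrK 1) -!biedge_target xw //.
by move: zn; clear; move: (sval z) => {}z; lia.
Qed.

Lemma ray_le (D : digraph) (w x : biwalk D) m n :
  ray w n x -> m <= n -> ray w m x.
Proof. by move=> /rayP wx mn; apply/rayP => i im; apply: wx; lia. Qed.

Lemma ray_eq (D : digraph) (w x : biwalk D) n : ray w n x -> ray w n = ray x n.
Proof. by rewrite /ray /= => ->. Qed.

Lemma ray_sub (D : digraph) (w x : biwalk D) n m :
  ray w n x -> n <= m -> ray x m `<=` ray w n.
Proof. by move=> /ray_eq -> nm y /ray_le; apply. Qed.

Lemma ray_bivertex (D : digraph) (w x : biwalk D) n :
  ray w n x -> bivertex x n = bivertex w n.
Proof.
by move=> /rayP wx; rewrite -[n](subrK 1) -!biedge_target wx //; lia.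
Qed.

Definition shifted (D : digraph) (k : int) (x : biwalk D) : biwalk D :=
  hom_comp (shift k) x.

Lemma biedge_shifted (D : digraph) k (x : biwalk D) i :
  biedge (shifted k x) i = biedge x (i + k).
Proof. by rewrite /biedge /= biedgeE. Qed.

Lemma bivertex_shifted (D : digraph) k (x : biwalk D) i :
  bivertex (shifted k x) i = bivertex x (i + k).
Proof. by rewrite -!biedge_source biedge_shifted. Qed.

Lemma shifted_shifted (D : digraph) k l (x : biwalk D) :
  shifted k (shifted l x) = shifted (k + l) x.
Proof. by apply: biwalk_eq => i; rewrite !biedge_shifted addrA. Qed.

Lemma shifted0 (D : digraph) (x : biwalk D) : shifted 0 x = x.
Proof. by apply: biwalk_eq => i; rewrite biedge_shifted addr0. Qed.

Lemma shift_orbit_shifted (D : digraph) k (x : biwalk D) :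
  shift_orbit (shifted k x) = shift_orbit x.
Proof.
apply/seteqP; split => y [l _ <-].
  by exists (l + k) => //; rewrite -/(shifted _ _) -shifted_shifted.
exists (l - k) => //.
by rewrite -!/(shifted _ _) shifted_shifted subrK.
Qed.

Lemma shift_orbit_inj (D : digraph) (x y : biwalk D) :
  shift_orbit x = shift_orbit y -> exists k, x = shifted k y.
Proof.
move=> xy; have : shift_orbit x x by exists 0 => //; exact: shifted0.
by rewrite xy => -[k _ <-]; exists k.
Qed.

Lemma ray_shifted (D : digraph) (w x : biwalk D) k n :
  ray w n x -> ray (shifted k w) (n - k) (shifted k x).
Proof.
by move=> /rayP wx; apply/rayP => i ik; rewrite !biedge_shifted wx //; lia.
Qed.

Lemma uray_shifted (D : digraph) (w : biwalk D) k n :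
  uray (shifted k w) (n - k) = uray w n.
Proof.
apply/seteqP; split => X [x wx <-]; last first.
  by exists (shifted k x); [exact: ray_shifted|exact: shift_orbit_shifted].
exists (shifted (- k) x); last exact: shift_orbit_shifted.
have := ray_shifted (- k) wx.
by rewrite shifted_shifted addNr shifted0 opprK subrK.
Qed.

(** If [x] and its shift by [k] share the past of [w] up to [n], then the past
    of [w] has period [k], which irrationality allows only for [k = 0]. *)
Lemma irrational_no_shift (D : digraph) (w x : biwalk D) n k :
  irrational_past w -> ray w n x -> ray w n (shifted k x) -> k = 0.
Proof.
move=> wi /rayP wx /rayP wy; apply: contrapT => k0; apply: wi.
have per m : m < n -> m + k < n -> biedge w m = biedge w (m + k).
  by move=> mn mkn; rewrite -wy // biedge_shifted wx.
have per' i : i < n -> biedge w i = biedge w (i - `|k|).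
  move=> iltn; have [kp|kn] := ltrP 0 k.
    by rewrite (per (i - `|k|)) ?(gtr0_norm kp) ?subrK //; lia.
  by rewrite ler0_norm // opprK per //; lia.
exists (Num.min n 0), (- `|k|); split => [||a b an ba|a b an ba].
- by rewrite ge_min lexx orbT.
- by lia.
- by rewrite /= !bivertexE /= -!biedge_source ba -per' //; lia.
- by rewrite /= !biedgeE /= ba -per' //; lia.
Qed.

(** Orbits lose no information inside one irrational ray: this is what lets
    disjointness and covering of unindexed rays be read off from indexed
    walks. *)
Lemma uray_ray (D : digraph) (w x : biwalk D) n :
  irrational_past w -> ray w n x ->
  forall y, ray w n y -> shift_orbit x = shift_orbit y -> x = y.
Proof.
move=> wi wx y wy /shift_orbit_inj[k xE].
rewrite xE in wx *.
by rewrite (irrational_no_shift wi wy wx) shifted0.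
Qed.

(** Rationality concerns only the walk far in the past, where [x] and [w]
    agree. *)
Lemma irrational_ray (D : digraph) (w x : biwalk D) n :
  irrational_past w -> ray w n x -> irrational_past x.
Proof.
move=> wi /rayP wx [a [q [a0 q0 _ per]]]; apply: wi.
have in0 i : i < 0 -> i \in Zbwd 0 by rewrite in_Zbwd; lia.
have in1 i : i < 0 -> i + 1 \in Zbwd 0 by rewrite in_Zbwd; lia.
have xper i : i < a -> biedge x i = biedge x (i + q).
  move=> ia; have i0 : i < 0 by lia.
  have iq0 : i + q < 0 by lia.
  have := per (Zedge (in0 _ i0) (in1 _ i0)) (Zedge (in0 _ iq0) (in1 _ iq0)).
  by rewrite /= !biedgeE /= => ->.
have wper i : i < Num.min a n -> biedge w i = biedge w (i + q).
  move=> ia; have [ia' iltn iqn] : [/\ i < a, i < n & i + q < n] by split; lia.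
  by rewrite -(wx _ iltn) (xper _ ia') (wx _ iqn).
exists (Num.min a n), q; split => // [|c b ia ba|c b ia ba].
- by lia.
- by rewrite /= !bivertexE /= -!biedge_source ba wper.
- by rewrite /= !biedgeE /= ba wper.
Qed.

Lemma ray_stream (D : digraph) (w : biwalk D) n s :
  stream (bivertex w n) s ->
  exists x, ray w n x /\ forall k : nat, biedge x (n + k%:Z) = s k.
Proof.
move=> [s0 sS].
pose e i := if i < n then biedge w i else s (absz (i - n)).
have [i|x [xE _]] := @biwalk_of_edges D e.
  rewrite /e; case: ltrP => i0; case: ltrP => i1.
  - by rewrite biedge_target biedge_source.
  - have -> : n = i + 1 by lia.
    by rewrite subrr s0 biedge_target; congr bivertex; lia.
  - by lia.
  - by rewrite sS; congr (source (s _)); lia.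
have xe i : biedge x i = e i by rewrite /biedge xE.
exists x; split; first by apply/rayP => i iltn; rewrite xe /e iltn.
by move=> k; rewrite xe /e ltNge lerDl /= addrAC subrr add0r.
Qed.

(** Unindexed rays are nested or disjoint.  If two of them share the orbit of
    [x], a shift brings both pasts onto [x], and the one fixing the longer past
    is the smaller.  The common part is described twice, as a sub-ray of each of
    the two given representations: a ray can have several central vertices, so
    both descriptions must come with the same one. *)
Lemma uray_inter (D : digraph) (w w' : biwalk D) n n' :
  uray w n `&` uray w' n' !=set0 ->
  exists x m x' m', [/\ ray w n x /\ n <= m, ray w' n' x' /\ n' <= m',
    uray w n `&` uray w' n' = uray x m, uray x' m' = uray x m &
    bivertex x' m' = bivertex x m].
Proof.
move=> [X [[x wx <-] [x' wx' xx']]].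
have [k x'E] := shift_orbit_inj xx'.
have urayE : uray x' (Num.max n (n' + k) - k) = uray x (Num.max n (n' + k)).
  by rewrite x'E uray_shifted.
exists x, (Num.max n (n' + k)), x', (Num.max n (n' + k) - k).
have nm : n <= Num.max n (n' + k) by lia.
have nm' : n' <= Num.max n (n' + k) - k by lia.
split=> //; last by rewrite x'E bivertex_shifted subrK.
apply/seteqP; split => [Y|Y Yx]; last first.
  split; first by move: Y Yx; apply/image_subset/ray_sub.
  by move: Y Yx; rewrite -urayE; apply/image_subset/ray_sub.
have [le|le] := orP (le_total (n' + k) n).
  by rewrite (max_idPl le) /uray (ray_eq wx) => -[].
by rewrite -urayE (max_idPr le) addrK /uray (ray_eq wx') => -[].
Qed.

(** * Decompositions of rays *)

Lemma biedge_core (D : fdigraph) (x : biwalk D) i : biedge x i \in coreE D.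
Proof. by apply/mem_set; exists x, i. Qed.

Lemma bivertex_core (D : fdigraph) (x : biwalk D) i : bivertex x i \in coreV D.
Proof. by apply/mem_set; exists x, i. Qed.

Definition core_edge (D : fdigraph) (x : biwalk D) i : fedge (core D) :=
  exist _ (biedge x i) (biedge_core x i).

Definition core_vertex (D : fdigraph) (x : biwalk D) i : fvertex (core D) :=
  exist _ (bivertex x i) (bivertex_core x i).

Lemma core_source_edge (D : fdigraph) (x : biwalk D) i :
  fsource (core_edge x i) = core_vertex x i.
Proof. by exact/val_inj/(biedge_source x i). Qed.

Lemma core_target_edge (D : fdigraph) (x : biwalk D) i :
  ftarget (core_edge x i) = core_vertex x (i + 1).
Proof. by exact/val_inj/(biedge_target x i). Qed.

Lemma core_stream (D : fdigraph) (x : biwalk D) n :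
  stream (core_vertex x n : vertex (core D)) (fun k => core_edge x (n + k%:Z)).
Proof.
split=> [|k] /=; first by rewrite addr0 -core_source_edge.
transitivity (core_vertex x (n + k%:Z + 1)).
  by rewrite -core_target_edge.
by rewrite -addrA -PoszD addn1 -core_source_edge.
Qed.

Lemma core_live (D : fdigraph) (u : fvertex (core D)) :
  exists s, stream (u : vertex (core D)) s.
Proof.
have /set_mem[x [i xi]] := svalP u.
have -> : u = core_vertex x i by apply: val_inj.
by exists (fun k => core_edge x (i + k%:Z)); exact: core_stream.
Qed.

(** The word that singles out the sub-ray of [x] at [m] inside the ray of [x]
    at [n]. *)
Definition core_code (D : fdigraph) (x : biwalk D) (n m : int) :
  seq (fedge (core D)) := mkseq (fun k => core_edge x (n + k%:Z)) `|m - n|%N.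

Lemma core_code_end (D : fdigraph) (x : biwalk D) n m : n <= m ->
  seq_end (core_vertex x n) (core_code x n m) = core_vertex x m.
Proof.
move=> nm; have [k ->] : exists k : nat, m = n + k%:Z.
  by exists `|m - n|%N; lia.
rewrite /core_code addrAC subrr add0r absz_nat.
case: k => [|k]; first by rewrite addr0.
rewrite /seq_end -map_comp -/(mkseq _ _) (last_nth (core_vertex x n)) size_mkseq [LHS]/=.
rewrite nth_mkseq //.
rewrite (_ : (_ \o _) k = ftarget (core_edge x (n + k%:Z))) //.
by rewrite core_target_edge -addrA -PoszD addn1.
Qed.

Lemma begins_core_code (D : fdigraph) (x : biwalk D) n m s :
  begins s (core_code x n m) <->
  forall k : nat, (k < `|m - n|)%N -> s k = core_edge x (n + k%:Z).
Proof.
rewrite /begins /core_code size_mkseq; split=> [/eqP sE k km|sE]; last first.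
  by apply/eqP/eq_in_map => k; rewrite mem_iota => /andP[_]; exact: sE.
by move/(congr1 (fun q => nth (s 0%N) q k)): sE; rewrite !nth_mkseq.
Qed.

(** When finitely many disjoint sub-rays cover an irrational ray, the finite
    walks leading from the central vertex of the ray to theirs form a complete
    prefix code: an infinite walk from the central vertex, glued to the past of
    [w], lies in exactly one sub-ray. *)
Lemma uray_expansion (D : fdigraph) (w : biwalk D) n (I : finType)
    (A : {set I}) (x : I -> biwalk D) (m : I -> int) :
  irrational_past w ->
  (forall i, i \in A -> ray w n (x i) /\ n <= m i) ->
  (forall i j, i \in A -> j \in A ->
     uray (x i) (m i) `&` uray (x j) (m j) !=set0 -> i = j) ->
  uray w n `<=` \bigcup_(i in [set` A]) uray (x i) (m i) ->
  expansion (core_vertex w n) (\sum_(i in A) free_gen (core_vertex (x i) (m i))).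
Proof.
move=> wi wx disj cov.
have wxv i : i \in A -> core_vertex (x i) n = core_vertex w n.
  by move=> /wx[wxi _]; exact/val_inj/(ray_bivertex wxi).
rewrite (eq_bigr (fun i =>
  free_gen (seq_end (core_vertex w n) (core_code (x i) n (m i))))); last first.
  by move=> i iA; rewrite -(wxv i iA) core_code_end //; case: (wx i iA).
apply: (@code_expansion _ _ (\max_(i in A) size (core_code (x i) n (m i)))%N).
- exact: core_live.
- by move=> i iA; exact: leq_bigmax_cond.
- move=> i iA; exists (fun k => core_edge (x i) (n + k%:Z)); split.
    by rewrite -(wxv i iA); exact: core_stream.
  by apply/begins_core_code.
move=> s ws.
(* The stream continues the past of [w] to a bi-infinite walk [y]. *)
have [|y [wy yE]] := @ray_stream D w n (sval \o s).
  case: ws => s0 sS; split=> [|k]; first by move/(congr1 sval): s0.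
  by have /(congr1 sval) := sS k.
have yx i : i \in A -> begins s (core_code (x i) n (m i)) <-> ray (x i) (m i) y.
  move=> iA; have [wxi nm] := wx i iA; rewrite begins_core_code.
  split=> [sx|/rayP yx k km].
    apply/rayP => j jm; have [jn|nj] := ltrP j n.
      by rewrite (ray_edge wy) // (ray_edge wxi).
    have -> : j = n + `|j - n|%N%:Z by lia.
    by rewrite yE /= sx //; lia.
  by apply: val_inj; rewrite /= -yx -?yE //; lia.
have /cov[i iA [z zx zy]] : uray w n (shift_orbit y) by exists y.
exists i; split.
  split=> //; apply/yx => //; rewrite -(_ : z = y) //.
  have [wxi nm] := wx i iA.
  apply: (uray_ray wi _ wy zy); exact: ray_sub zx.
move=> j [jA /(yx j jA) yj]; apply: disj => //; exists (shift_orbit y); split.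
  by exists z.
by exists y.
Qed.

(** * Vertex counts of a common beam *)

Lemma vertex_count_family (D : fdigraph) (I : finType) (A : {set I})
    (x : I -> biwalk D) (m : I -> int) :
  (forall i, i \in A -> irrational_past (x i)) ->
  (forall i j, i \in A -> j \in A ->
     uray (x i) (m i) `&` uray (x j) (m j) !=set0 -> i = j) ->
  vertex_count (\sum_(i in A) free_gen (core_vertex (x i) (m i)))
    (\bigcup_(i in [set` A]) uray (x i) (m i)).
Proof.
move=> xi disj; exists #|A|, (fun i => uray (x (enum_val i)) (m (enum_val i))).
exists (fun i => bivertex (x (enum_val i)) (m (enum_val i))); split.
- move=> i; exists (x (enum_val i)), (m (enum_val i)).
  by split=> //; apply/xi/enum_valP.
- apply/trivIsetP => i j _ _ ij; apply: contrapT => /eqP/set0P ne.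
  by case/eqP: ij; apply/enum_val_inj/disj => //; exact: enum_valP.
- apply/seteqP; split => X; last first.
    by move=> [i _ iX]; exists (enum_val i) => //; exact: enum_valP.
  by move=> [i iA iX]; exists (enum_rank_in iA i) => //; rewrite enum_rankK_in.
- move=> v; rewrite sum_ffunE big_enum_val -[RHS]sum1_card [RHS]big_mkcond /=.
  by apply: eq_bigr => i _; rewrite ffunE -val_eqE /= inE; case: eqP.
Qed.

Lemma vertex_countE (D : fdigraph) M (B : set (set (biwalk D))) :
  vertex_count M B -> exists k (x : 'I_k -> biwalk D) (m : 'I_k -> int),
    [/\ forall i, irrational_past (x i),
        forall i j, uray (x i) (m i) `&` uray (x j) (m j) !=set0 -> i = j,
        B = \bigcup_i uray (x i) (m i) &
        M = \sum_i free_gen (core_vertex (x i) (m i))].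
Proof.
move=> [k [X [c [Xc disj -> ME]]]].
have {Xc}/choice[f fP] : forall i, exists wn : biwalk D * int,
    [/\ irrational_past wn.1, X i = uray wn.1 wn.2 & bivertex wn.1 wn.2 = c i].
  by move=> i; have [w [n wn]] := Xc i; exists (w, n).
exists k, (fun i => (f i).1), (fun i => (f i).2); split.
- by move=> i; case: (fP i).
- move=> i j; have [_ <- _] := fP i; have [_ <- _] := fP j.
  exact: disj.
- by apply: eq_bigcupr => i _; case: (fP i).
- apply/ffunP => v; rewrite ME sum_ffunE -sum1_card [LHS]big_mkcond /=.
  apply: eq_bigr => i _; have [_ _ ci] := fP i.
  by rewrite ffunE -val_eqE inE /= ci; case: eqP.
Qed.

(** Double counting over the common refinement.  Two decompositions of a beam
    into rays are refined by the nonempty intersections of a ray of the first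
    with a ray of the second, which are rays by [uray_inter].  Each ray of
    either decomposition expands into its intersections with the rays of the
    other, so both counts are congruent to the count of the refinement. *)
Lemma common_beam_congr (D : fdigraph) (r : set _) M1 M2 :
  is_congruence r -> adj_relations (core D) `<=` r ->
  common_beam D (M1, M2) -> r (M1, M2).
Proof.
move=> rc radj [B /= [_]].
move=> /vertex_countE[k [x [n [xi xd -> ->]]]].
move=> /vertex_countE[l [y [p [yi yd BE ->]]]].
(* For each meeting pair, [h] records the intersection as a sub-ray of [x i]
   (first component) and of [y j] (second component). *)
pose T := (biwalk D * int)%type.
have meet (ij : 'I_k * 'I_l) : exists h : T * T,
    uray (x ij.1) (n ij.1) `&` uray (y ij.2) (p ij.2) !=set0 ->
  [/\ ray (x ij.1) (n ij.1) h.1.1 /\ n ij.1 <= h.1.2,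
      ray (y ij.2) (p ij.2) h.2.1 /\ p ij.2 <= h.2.2,
      uray (x ij.1) (n ij.1) `&` uray (y ij.2) (p ij.2) = uray h.1.1 h.1.2,
      uray h.2.1 h.2.2 = uray h.1.1 h.1.2 &
      core_vertex h.2.1 h.2.2 = core_vertex h.1.1 h.1.2].
  case: ij => i j /=.
  have [/uray_inter[a [m [b [q [ha hb e1 e2 e3]]]]]|ne] :=
    pselect (uray (x i) (n i) `&` uray (y j) (p j) !=set0); last first.
    by exists ((x i, n i), (y j, p j)).
  by exists ((a, m), (b, q)) => _; split=> //; apply: val_inj.
have [h hP] := choice meet.
pose P i j := `[< uray (x i) (n i) `&` uray (y j) (p j) !=set0 >].
have [[rr rs rt] _] := rc.
apply: (rt _ (\sum_i \sum_(j in [set j | P i j]%SET)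
    free_gen (core_vertex (h (i, j)).1.1 (h (i, j)).1.2))).
  apply: congruence_sum => // i _; apply: expansion_congr => //.
  apply: uray_expansion => //.
  - by move=> j; rewrite inE => /asboolP ij; have [] := hP (i, j) ij.
  - move=> j j'; rewrite inE => /asboolP ij; rewrite inE => /asboolP ij'.
    have [_ _ <- _ _] := hP (i, j) ij; have [_ _ <- _ _] := hP (i, j') ij'.
    by move=> [X [[_ Xj] [_ Xj']]]; apply: yd; exists X.
  - move=> X Xi; have : (\bigcup_i uray (x i) (n i)) X by exists i.
    rewrite BE => -[j _ Xj]; have ne : uray (x i) (n i) `&` uray (y j) (p j) !=set0.
      by exists X.
    by exists j; [rewrite /= inE; exact/asboolP|have [_ _ <- _ _] := hP (i, j) ne].
rewrite [X in r (X, _)](_ : _ = \sum_j \sum_(i in [set i | P i j]%SET)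
    free_gen (core_vertex (h (i, j)).2.1 (h (i, j)).2.2)); last first.
  under eq_bigr do rewrite big_mkcond.
  rewrite exchange_big; apply: eq_bigr => j _.
  rewrite [RHS]big_mkcond; apply: eq_bigr => i _.
  rewrite inE [in RHS]inE; case: ifP => // /asboolP ij.
  by have [_ _ _ _ /= <-] := hP (i, j) ij.
apply: congruence_sum => // j _; apply: rs; apply: expansion_congr => //.
apply: uray_expansion => //.
- by move=> i; rewrite inE => /asboolP ij; have [] := hP (i, j) ij.
- move=> i i'; rewrite inE => /asboolP ij; rewrite inE => /asboolP ij'.
  have [_ _ + -> _] := hP (i, j) ij; have [_ _ + -> _] := hP (i', j) ij'.
  move=> <- <-.
  by move=> [X [[Xi _] [Xi' _]]]; apply: xd; exists X.
- move=> X Xj; have : (\bigcup_j uray (y j) (p j)) X by exists j.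
  rewrite -BE => -[i _ Xi]; have ne : uray (x i) (n i) `&` uray (y j) (p j) !=set0.
    by exists X.
  exists i; first by rewrite /= inE; exact/asboolP.
  by have [_ _ + -> _] := hP (i, j) ne => <-.
Qed.

(** A ray with central vertex [v] is the disjoint union, over the edges [e]
    leaving [v], of the rays that continue its past along [e]; these have the
    targets of the edges as central vertices.  So [v] and the right-hand side of
    its defining relation count the same beam. *)
Lemma adj_common_beam (D : udaf) (v : fvertex (core D)) :
  common_beam D (free_gen v, \sum_(w : fvertex (core D)) free_gen w *+ Adj v w).
Proof.
(* An irrational past ending at [v] comes from [fresh_ray] for the empty
   family of rays. *)
have fresh := @fresh_ray D (sval v) 0 (fun i => False_rect _ (notF (ltn_ord i)))
  (fun _ => 0) (udafP D) (set_mem (svalP v)).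
have [w [wi wv _]] := fresh.
have wvE : core_vertex w 0 = v by apply: val_inj.
pose A := [set e : fedge (core D) | fsource e == v]%SET.
have ext e : exists x, e \in A -> ray w 0 x /\ core_edge x 0 = e.
  have [|] := boolP (e \in A); last by exists w.
  rewrite inE => /eqP ev; have [s es] := core_live (ftarget e).
  have [|x [wx xE]] := @ray_stream D w 0 (sval \o scons e s).
    have [s0 sS] := stream_scons es; split=> [|k].
      by rewrite wv -ev; move/(congr1 sval): s0.
    by have /(congr1 sval) := sS k.
  by exists x => _; split=> //; apply: val_inj; exact: (xE 0%N).
have [x xP] := choice ext.
have BE : uray w 0 = \bigcup_(e in [set` A]) uray (x e) 1.
  apply/seteqP; split => X.
    move=> [y wy <-]; exists (core_edge y 0).
      by rewrite /= inE core_source_edge -wvE -val_eqE /= (ray_bivertex wy).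
    have yA : core_edge y 0 \in A.
      by rewrite inE core_source_edge -wvE -val_eqE /= (ray_bivertex wy).
    exists y => //; apply/rayP => i i1; have [wx xE] := xP _ yA.
    have [i0|i0] := ltrP i 0; first by rewrite (ray_edge wy) // (ray_edge wx).
    have -> : i = 0 by lia.
    by have /(congr1 sval) := xE.
  move=> [e /xP[wx _]]; apply: image_subset; exact: ray_sub wx _.
have disj e f : e \in A -> f \in A -> uray (x e) 1 `&` uray (x f) 1 !=set0 -> e = f.
  move=> /xP[we xe] /xP[wf xf] [X [[y ye <-] [z zf zy]]].
  have wy : ray w 0 y by exact: ray_sub we _ _ ye.
  have wz : ray w 0 z by exact: ray_sub wf _ _ zf.
  have zE := uray_ray wi wz wy zy.
  rewrite -xe -xf; apply: val_inj; rewrite /=.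
  by rewrite -(ray_edge ye) // -(ray_edge zf) ?zE.
have c1 : vertex_count (free_gen v) (uray w 0).
  have := @vertex_count_family D unit [set: unit]%SET (fun _ => w) (fun _ => 0).
  rewrite big_const cardsT card_unit /= addr0 wvE.
  rewrite (_ : \bigcup_(i in _) _ = uray w 0); first by apply=> // -[] [].
  apply/seteqP; split => X; first by case.
  by exists tt => //=; rewrite inE.
have c2 : vertex_count (\sum_(w : fvertex (core D)) free_gen w *+ Adj v w) (uray w 0).
  rewrite sum_free_gen_Adj BE.
  have := @vertex_count_family D _ A x (fun=> 1) _ disj.
  rewrite (_ : \sum_(e in A) _ =
     \sum_(e : fedge (core D) | fsource e == v) free_gen (ftarget e)).
    by apply=> e /xP[wx _]; exact: irrational_ray wx.
  apply: eq_big => [e|e eA]; first by rewrite inE.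
  by have [_ xe] := xP e eA; rewrite -[in RHS]xe core_target_edge.
exists (uray w 0); split=> //; exact: vertex_count_ubeam c1.
Qed.

(** * Elementary refiners *)

Lemma fwalk_of_stream (D : digraph) (v : vertex D) s : stream v s ->
  exists h : fwalk D, fwalk_start h = v /\
    forall e, homE h e = s `|sval e|%N.
Proof.
move=> [s0 sS].
pose f (x : vertex (Zitv Zfwd)) : vertex D := source (s `|sval x|%N).
pose g (e : edge (Zitv Zfwd)) : edge D := s `|sval e|%N.
have gt e : target (g e) = f (target e).
  rewrite /f /g sS /=; congr (source (s _)).
  by have /andP[] := svalP e; rewrite in_Zfwd; move: (sval e) => i; lia.
by exists (@DHom (Zitv Zfwd) D f g (fun=> erefl) gt).
Qed.

Lemma stream_of_fwalk (D : digraph) (h : fwalk D) : exists s,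
  stream (fwalk_start h) s /\ forall e, homE h e = s `|sval e|%N.
Proof.
have k0 (k : nat) : k%:Z \in Zfwd by rewrite in_Zfwd.
have k1 (k : nat) : k%:Z + 1 \in Zfwd by rewrite in_Zfwd.
exists (fun k => homE h (Zedge (k0 k) (k1 k))); split; first split.
- by rewrite hom_source; congr homV; exact: val_inj.
- move=> k; rewrite hom_source hom_target; congr homV.
  by apply: val_inj => /=; lia.
- move=> e; congr homE; apply: val_inj => /=.
  by have /andP[] := svalP e; rewrite in_Zfwd; move: (sval e) => i; lia.
Qed.

Lemma Zseg_hom_eq (D : digraph) n (g g' : dhom (Zitv (Zseg n)) D) :
  homV g (Zpoint (Zseg_first n)) = homV g' (Zpoint (Zseg_first n)) ->
  homE g =1 homE g' -> g = g'.
Proof.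
move=> g0 gE; apply: hom_eq => // x; have xn := svalP x.
have [x0|x0] := eqVneq (sval x) 0.
  by have -> : x = Zpoint (Zseg_first n) by exact: val_inj.
have i0 : sval x - 1 \in Zseg n by move: xn x0; rewrite !in_Zseg; lia.
have i1 : sval x - 1 + 1 \in Zseg n by rewrite subrK.
have -> : x = target (Zedge i0 i1) by apply: val_inj; rewrite /= subrK.
by rewrite -!hom_target gE.
Qed.

(** Where every vertex starts an infinite walk, a finite walk is determined by
    its length and an infinite extension.  This turns the dependently typed
    finite walks into prefixes of edge sequences. *)
Lemma finwalk_stream (D : digraph) (p : finwalk D) :
  (forall u : vertex D, exists s, stream u s) ->
  exists s, stream (finwalk_start p) s /\
    forall e, homE (projT2 p) e = s `|sval e|%N.
Proof.
case: p => n g live; rewrite /finwalk_start /=.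
have [s [s0 sS]] := live (homV g (Zpoint (Zseg_last n))).
have /choice[t tP] (k : nat) : exists e', (n <= k -> e' = s (k - n))%N /\
    forall e : edge (Zitv (Zseg n)), sval e = k%:Z -> e' = homE g e.
  have [nk|kn] := leqP n k.
    exists (s (k - n)%N); split=> // e ek; have /andP[_] := svalP e.
    by rewrite ek in_Zseg; lia.
  have i0 : k%:Z \in Zseg n by rewrite in_Zseg; lia.
  have i1 : k%:Z + 1 \in Zseg n by rewrite in_Zseg; lia.
  exists (homE g (Zedge i0 i1)); split=> [|e ek]; first by lia.
  by congr homE; apply: val_inj.
have t_ge k : (n <= k)%N -> t k = s (k - n)%N by case: (tP k).
have t_src k (kn : k%:Z \in Zseg n) : source (t k) = homV g (Zpoint kn).
  have [nk|nk] := leqP n k.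
    have nkE : n = k by move: kn; rewrite in_Zseg; lia.
    rewrite t_ge //; have -> : (k - n)%N = 0%N by lia.
    by rewrite s0; congr homV; apply: val_inj; rewrite /= nkE.
  have i1 : k%:Z + 1 \in Zseg n by rewrite in_Zseg; lia.
  have [_ tE] := tP k; rewrite (tE (Zedge kn i1) erefl).
  by rewrite hom_source; congr homV; apply: val_inj.
exists t; split; first split.
- by rewrite (t_src 0%N (Zseg_first n)).
- move=> k; have [nk|kn] := leqP n k.
    by rewrite !t_ge ?sS ?subSn //; lia.
  have i0 : k%:Z \in Zseg n by rewrite in_Zseg; lia.
  have i1 : k%:Z + 1 \in Zseg n by rewrite in_Zseg; lia.
  have i2 : k.+1%:Z \in Zseg n by rewrite in_Zseg; lia.
  have [_ tE] := tP k; rewrite (tE (Zedge i0 i1) erefl).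
  by rewrite t_src hom_target; congr homV; apply: val_inj => /=; lia.
- move=> e; have [_ tE] := tP `|sval e|%N; rewrite (tE e) //.
  by have /andP[] := svalP e; rewrite in_Zseg; move: (sval e) => i; lia.
Qed.

Lemma begins_withP (C : fdigraph) (h : fwalk C) (p : finwalk C) s t :
  (forall e, homE h e = s `|sval e|%N) ->
  (forall e, homE (projT2 p) e = t `|sval e|%N) ->
  fwalk_start h = finwalk_start p ->
  begins_with h p <-> begins s (mkseq t (projT1 p)).
Proof.
case: p => n g /= hs gt; rewrite /finwalk_start /= => h0.
rewrite /begins_with /= /begins size_mkseq.
have startE : homV (restr (@sub_Zseg_fwd n) h) (Zpoint (Zseg_first n)) =
    homV g (Zpoint (Zseg_first n)).
  by rewrite -h0 /fwalk_start /=; congr (homV h _); apply: val_inj.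
split=> [hg|/eqP st].
  apply/eqP/eq_in_map => k; rewrite mem_iota => /andP[_ kn].
  have i0 : k%:Z \in Zseg n by rewrite in_Zseg; lia.
  have i1 : k%:Z + 1 \in Zseg n by rewrite in_Zseg; lia.
  have := congr1 (fun f => homE f (Zedge i0 i1)) hg.
  by rewrite /= hs gt.
apply: Zseg_hom_eq => // e; rewrite /= hs gt /=.
have en : (`|sval e| < n)%N.
  by have /andP[] := svalP e; rewrite !in_Zseg; move: (sval e) => i; lia.
move/(congr1 (fun q => nth (t 0%N) q `|sval e|%N)): st.
by rewrite !nth_mkseq.
Qed.

Lemma finwalk_endE (C : fdigraph) (p : finwalk C) t :
  stream (finwalk_start p) t ->
  (forall e, homE (projT2 p) e = t `|sval e|%N) ->
  finwalk_end p = seq_end (finwalk_start p) (mkseq t (projT1 p)).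
Proof.
case: p => -[|n] g; rewrite /finwalk_end /finwalk_start /= => gs gt.
  by congr (homV g _); exact: val_inj.
rewrite /seq_end -map_comp -/(mkseq _ _).
rewrite (last_nth (ftarget (t 0%N))) size_mkseq [RHS]/= nth_mkseq //.
have i0 : n%:Z \in Zseg n.+1 by rewrite in_Zseg; lia.
have i1 : n%:Z + 1 \in Zseg n.+1 by rewrite in_Zseg; lia.
have /(congr1 (@target C)) := gt (Zedge i0 i1).
by rewrite hom_target /= => <-; congr (homV g _); apply: val_inj => /=; lia.
Qed.

Lemma card_finset (T : finType) (A : {set T}) : ([set` A] #= `I_#|A|)%card.
Proof.
apply/card_set_bijP; exists (fun x => index x (enum A)); split.
- by move=> x /= xA; rewrite cardE index_mem mem_enum.
- move=> x y /set_mem xA /set_mem yA xy.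
  have xe : x \in enum A by rewrite mem_enum.
  by rewrite -(nth_index x xe) xy nth_index ?mem_enum.
- move=> i /=; rewrite cardE => iA; case E: (enum A) iA => // [x0 s'].
  rewrite -E => iA; exists (nth x0 (enum A) i); last by rewrite index_uniq ?enum_uniq.
  by rewrite /= -mem_enum mem_nth.
Qed.

Lemma Zseg1_edge (x : edge (Zitv (Zseg 1))) : sval x = 0.
Proof. by have /andP[] := svalP x; rewrite !in_Zseg; move: (sval x) => i; lia. Qed.

Definition edge_walk (D : digraph) (e : edge D) : finwalk D.
Proof.
refine (existT _ 1%N (@DHom (Zitv (Zseg 1)) D
  (fun x => if sval x == 0 then source e else target e) (fun=> e) _ _)).
- by move=> x; rewrite /= Zseg1_edge.
- by move=> x; rewrite /= Zseg1_edge.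
Defined.

Lemma edge_walk_start (D : digraph) (e : edge D) :
  finwalk_start (edge_walk e) = source e.
Proof. by []. Qed.

Lemma edge_walk_end (D : digraph) (e : edge D) :
  finwalk_end (edge_walk e) = target e.
Proof. by []. Qed.

Lemma edge_walk_inj (D : digraph) : injective (@edge_walk D).
Proof.
move=> e f ef.
have i0 : 0 \in Zseg 1 by [].
have i1 : 0 + 1 \in Zseg 1 by [].
have stE (p : finwalk D) : edge_walk e = p -> 
   exists x, homE (projT2 p) x = e.
  by move=> <-; exists (Zedge i0 i1).
by have [x] := stE _ ef.
Qed.

(** The set of walks [P] of an elementary refiner is finite, because its
    members with a given end vertex are counted by [S] and there are finitely
    many vertices.  Numbering the walks by pairs of an end vertex [u] and an
    index below [S u] makes [P] a code to which [code_expansion] applies, with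
    [S] as its multiset of end vertices. *)
Lemma elementary_refiner_expansion (C : fdigraph) R :
  (forall u : fvertex C, exists s, stream (u : vertex C) s) ->
  elementary_refiner C R ->
  exists v S, expansion v S /\ R = [ffun u => (S u)%:Z - (u == v)%:Z].
Proof.
move=> live [v [P [S [Pv Pu PS RE]]]].
exists v, S; split; last by apply/ffunP => u; rewrite ffunE RE.
have {PS}/choice[f fP] u : exists f : finwalk C -> nat,
    set_bij [set p | P p /\ finwalk_end p = u] `I_(S u) f.
  exact/card_set_bijP.
pose I := {u : fvertex C & 'I_(S u)}.
have /choice[p pP] (i : I) : exists p : finwalk C,
    [/\ P p, finwalk_end p = tag i & f (tag i) p = tagged i :> nat].
  case: i => u i /=; have [_ _ fs] := fP u.
  by have [p [pP pu] fp] := fs i (ltn_ord i); exists p.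
have p_onto q : P q -> exists i, p i = q.
  move=> qP; have [fI fi _] := fP (finwalk_end q).
  have qI : (f (finwalk_end q) q < S (finwalk_end q))%N by apply: fI.
  exists (Tagged (fun u => 'I_(S u)) (Ordinal qI)).
  have [] := pP (Tagged (fun u => 'I_(S u)) (Ordinal qI)).
  move: (p _) => q' /= q'P q'u fq; apply: fi => //; exact: mem_set.
have p_inj : injective p.
  move=> [u i] [u' i'] e; have [_ /= eu ef] := pP (Tagged _ i).
  have [_ /=] := pP (Tagged _ i'); rewrite -e eu => uu.
  by subst u'; rewrite ef => /val_inj ->.
have /choice[t tP] (i : I) : exists s, stream (v : vertex C) s /\
    forall e, homE (projT2 (p i)) e = s `|sval e|%N.
  have [piP _ _] := pP i; rewrite -(Pv _ piP); exact: finwalk_stream.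
pose code i := mkseq (t i) (projT1 (p i)).
have -> : S = \sum_(i in [set: I]%SET) free_gen (seq_end v (code i)).
  rewrite (eq_bigr (fun i : I => free_gen (tag i))); last first.
    move=> i _; have [piP piE _] := pP i; have [ts te] := tP i; rewrite -piE.
    by rewrite -(Pv _ piP) in ts *; rewrite (finwalk_endE ts te).
  apply/ffunP => u; rewrite sum_ffunE.
  rewrite (eq_bigl predT); last by move=> i; rewrite inE.
  rewrite -(sig_big_dep predT (fun _ => predT)
    (fun u' (_ : 'I_(S u')) => free_gen u' u)) /=.
  rewrite (bigD1 u) //= [X in _ + X]big1 ?addr0 => [|u' /negPf u'u].
    rewrite (eq_bigr (fun=> 1%N)) => [|i _]; last by rewrite ffunE eqxx.
    by rewrite sum1_card card_ord.
  by rewrite big1 // => i _; rewrite ffunE u'u.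
apply: (@code_expansion _ _ (\max_i size (code i))%N) => //.
- by move=> i _; exact: leq_bigmax.
- move=> i _; exists (t i); split; first by case: (tP i).
  by rewrite /begins /code size_mkseq.
move=> s /fwalk_of_stream[h [hv hE]].
have bP i : begins_with h (p i) <-> begins s (code i).
  by have [piP _ _] := pP i; have [_ te] := tP i; apply: begins_withP; rewrite ?Pv.
have [q [[qP qh] qu]] := Pu h hv; have [i iq] := p_onto q qP.
exists i; split; first by split; [rewrite inE|apply/bP; rewrite iq].
move=> j [_ /bP hj]; apply: p_inj; rewrite iq; apply: qu; split=> //.
by case: (pP j).
Qed.

(** The walks of length one from [v] form the code of this refiner. *)
Lemma Rel_row_elementary (C : fdigraph) (v : fvertex C) :
  elementary_refiner C (Rel_row v).
Proof.
pose out := [set e : fedge C | fsource e = v].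
exists v, (@edge_walk C @` out), [ffun u => Adj v u]; split.
- by move=> p [e ev <-]; rewrite edge_walk_start.
- move=> h hv; have [s [hs hE]] := stream_of_fwalk h.
  have hP (e : fedge C) : e \in out ->
      begins_with h (edge_walk (e : edge C)) <-> s 0%N = e.
    move=> /set_mem ev; rewrite (@begins_withP _ _ _ s (fun=> e)) //.
      by rewrite /begins /= [_ == _]andbT; split=> /eqP.
    by rewrite hv edge_walk_start.
  have so : s 0%N \in out by apply/mem_set; case: hs => + _; rewrite hv.
  exists (edge_walk (s 0%N)); split.
    by split; [exists (s 0%N) => //; exact: set_mem|apply/hP].
  by move=> _ [[e eo <-] /hP ->] //; exact: mem_set.
- move=> u; rewrite ffunE /Adj.
  pose A := [set e : fedge C | (fsource e == v) && (ftarget e == u)]%SET.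
  rewrite [X in (X #= _)%card](_ : _ = @edge_walk C @` [set` A]); last first.
    apply/seteqP; split => p.
      move=> [[e ev <-]]; rewrite edge_walk_end => eu; exists e => //=.
      by rewrite inE; apply/andP; split; apply/eqP.
    move=> [e /=]; rewrite inE => /andP[/eqP ev /eqP eu] <-.
    by split; [exists e|rewrite edge_walk_end].
  apply: card_eq_trans (inj_card_eq _) _.
    by move=> e f _ _; exact: edge_walk_inj.
  rewrite (_ : #|_| = #|A|); first exact: card_finset.
  by apply: eq_card => e; rewrite !inE.
- by move=> u; rewrite !ffunE /Rel eq_sym.
Qed.

Lemma generated_submonoid_sub (A : nmodType) (G H : set A) :
  G `<=` generated_submonoid H -> generated_submonoid G `<=` generated_submonoid H.
Proof. by move=> GH a; apply; split=> //; exact: generated_submonoidP. Qed.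

Lemma RefineE (D : fdigraph) :
  Refine D =
    generated_submonoid (range (fun v : fvertex (core D) => Rel_row v)).
Proof.
apply/seteqP; split; apply: generated_submonoid_sub => R.
  move=> /elementary_refiner_expansion[|v [S [vS ->]]]; first exact: core_live.
  exact: expansion_refiner.
by move=> [v _ <-] T [_]; apply; exact: Rel_row_elementary.
Qed.

(** * The presentation *)

(** The two relations are generated by different pairs, and as structures of
    different kinds: an equivalence on one side, a congruence on the other.
    Each side contains the generators of the other and is closed under what the
    other is generated by; that the dimension relation is a congruence is
    [dim_rel_congruence]. *)
Lemma dim_relE (D : udaf) :
  dim_rel D = congr_rel (generated_congruence (adj_relations (core D))).
Proof.
apply/seteqP; split => -[M1 M2] M12.
  apply: M12; split; first by case: (smallest_congruence (adj_relations (core D))).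
  move=> [N1 N2]; apply: common_beam_congr; first exact: smallest_congruence.
  by move=> a aR S [_]; apply.
apply: M12; split; first exact: dim_rel_congruence.
by move=> _ [v _ <-] S [_]; apply; exact: adj_common_beam.
Qed.

Lemma quot_monoid_iso (A : nmodType) (r s : congruence A) :
  congr_rel r = congr_rel s ->
  exists phi : {additive quot_monoid r -> quot_monoid s},
    bijective phi /\ forall a, phi (quot_class r a) = quot_class s a.
Proof.
move=> rs.
pose f (x : quot_monoid r) : quot_monoid s := quot_class s (repr x).
pose g (x : quot_monoid s) : quot_monoid r := quot_class r (repr x).
have fE a : f (quot_class r a) = quot_class s a.
  by apply/quot_classP; rewrite -rs; apply/quot_classP; rewrite quot_class_repr.
have gE a : g (quot_class s a) = quot_class r a.
  by apply/quot_classP; rewrite rs; apply/quot_classP; rewrite quot_class_repr.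
have f0 : f 0 = 0 by exact: fE.
have fD x y : f (x + y) = f x + f y.
  rewrite -(quot_class_repr x) -(quot_class_repr y) [X in f X]quot_addE !fE.
  by rewrite [RHS]quot_addE.
pose fA := GRing.isNmodMorphism.Build _ _ f (conj f0 fD).
pose phi : {additive quot_monoid r -> quot_monoid s} := HB.pack f fA.
exists phi; split=> //; exists g => x.
  by rewrite -(quot_class_repr x) /= fE gE.
by rewrite -(quot_class_repr x) /= gE fE.
Qed.

Theorem theorem6p4 (D : udaf) (hV : coreV D = setT) (hE : coreE D = setT) :
  (exists phi : {additive udaf_dim_monoid D ->
                          presented_monoid (adj_relations (core D))},
     bijective phi /\
     forall v : fvertex (core D),
       phi (dim_gen D v) = presented_gen (adj_relations (core D)) v) /\
  Refine D =
    generated_submonoid (range (fun v : fvertex (core D) => Rel_row v)).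
Proof.
split; last exact: RefineE.
have [phi [phi_bij phiE]] := @quot_monoid_iso _ (dim_congruence D) _ (dim_relE D).
by exists phi; split=> // v; exact: phiE.
Qed.
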